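(* Let $E$ be a directed graph with no heads and suppose that $F^0\subseteq E^0$ satisfies $E^0_{\mathrm{sing}}\subseteq F^0$. Suppose also that the subgraph $T$ of $E$ defined by $T^0 := E^0\setminus F^0$ and $T^1 := \{e\in E^1 : r_E(e),s_E(e)\in T^0\}$ is acyclic and that each of the following is satisfied: - (T1) each vertex in $F^0$ is the range of at most one $y\in E^\infty$ such that $s_E(y_i)\in T^0$ for all $i\ge 1$; and for each $x\in T^\infty$, - (T2) $r_E(x)\ge F^0$; - (T3) $|s_E^{-1}(r_E(x_i))|=1$ for all $i$; and - (T4) whenever $e \in E^1$ satisfies $s_E(e)=r_E(x)$, we have $|r_E^{-1}(r_E(e))|<\infty$. Let $F$ be the graph with vertex set $F^0$ and one edge $e_\beta$ for each path $\beta\in E^*\setminus E^0$ with $s_E(\beta),r_E(\beta)\in F^0$ and $s_E(\beta_i)\in T^0$ for $1\le i<|\beta|$, such that $s_F(e_\beta)=s_E(\beta)$ and $r_F(e_\beta)=r_E(\beta)$. Let $G\subseteq G_E$ denote the pointed groupoid with respect to $F^0$. Then 1. $G$ and $G_E$ are equivalent groupoids; and 2. $G$ is isomorphic (as a topological groupoid) to $G_F$.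
   Context: **Graphs.** A directed graph $E=(E^0,E^1,r_E,s_E)$ has vertex set $E^0$, edge set $E^1$ (no countability assumed) and range and source maps $r_E,s_E : E^1\to E^0$. A path is a sequence of edges $x=x_1x_2\cdots$ with $s_E(x_i)=r_E(x_{i+1})$; $|x|$ is its length, $r_E(x)=r_E(x_1)$, and for a finite path $s_E(x)=s_E(x_{|x|})$. Vertices are paths of length $0$ (with $r_E(v)=s_E(v)=v$). $E^*$ and $E^\infty$ are the sets of finite and infinite paths ($T^\infty$ is the set of infinite paths in $T$). A source is a vertex $v$ with $r_E^{-1}(v)=\emptyset$; an infinite receiver is a vertex $v$ with $r_E^{-1}(v)$ infinite. $E^0_{\mathrm{sing}} := \{v\in E^0 : r_E^{-1}(v)\text{ is empty or infinite}\}$. For $v\in E^0$ and $S\subseteq E^0$, $v\ge S$ means there is a path $\mu\in E^*$ with $r_E(\mu)\in S$ and $s_E(\mu)=v$. A head is an acyclic path $x\in E^\infty$ such that each $r_E(x_i)$ receives only $x_i$ (i.e. $r_E^{-1}(r_E(x_i))=\{x_i\}$) and each $s_E(x_i)$ emits only $x_i$ (i.e. $s_E^{-1}(s_E(x_i))=\{x_i\}$). **Graph groupoid.** Let $X := E^\infty\cup\{\mu\in E^* : s_E(\mu)\text{ is a source}\}\cup\{\mu\in E^* : s_E(\mu)\text{ is an infinite receiver}\}$ and $$G_E := \{(\alpha x,|\alpha|-|\beta|,\beta x) : \alpha,\beta\in E^*,\ x\in X,\ s_E(\alpha)=s_E(\beta)=r_E(x)\},$$ where $(x,k,y)$ has range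 $x$ and source $y$, $(x,k,y)(y,l,z)=(x,k+l,z)$, $(x,k,y)^{-1}=(y,-k,x)$, and the unit space is identified with $X$. For $\mu,\nu\in E^*$ with $s_E(\mu)=s_E(\nu)$ let $Z(\mu,\nu):=\{(\mu x,|\mu|-|\nu|,\nu x) : x\in X,\ s_E(\mu)=r_E(x)\}$, and for finite $K\subseteq E^*$ with $r_E(\alpha)=s_E(\mu)$ for all $\alpha\in K$ let $Z((\mu,\nu)\setminus K) := Z(\mu,\nu)\setminus\bigcup_{\alpha\in K}Z(\mu\alpha,\nu\alpha)$. These sets form a basis of compact open sets for a locally compact Hausdorff topology making $G_E$ an étale (indeed ample) groupoid. $G_F$ is defined in the same way from the graph $F$. **Pointed groupoid.** For $S\subseteq E^0$, the pointed groupoid with respect to $S$ is the subgroupoid of $G_E$ (with the subspace topology) consisting of the elements $(\alpha x,|\alpha|-|\beta|,\beta x)$ with $r_E(\alpha),r_E(\beta)\in S$. **Isomorphism.** An isomorphism of topological groupoids is a homeomorphism that is also an isomorphism of groupoids. **Equivalence of groupoids.** Let $G$ be a locally compact Hausdorff groupoid and $Y$ a locally compact Hausdorff space. $G$ acts on the left of $Y$ if there are a surjection $r_Y : Y\to G^{(0)}$ and a map $(\gamma,y)\mapsto\gamma\cdot y$ from $G*Y := \{(\gamma,y) : s(\gamma)=r_Y(y)\}$ to $Y$ such that (1) if $(\eta,y)\in G*Y$ and $(\gamma,\eta)$ is composable, then $(\gamma\eta,y),(\gamma,\eta\cdot y)\in G*Y$ and $\gamma\cdot(\eta\cdot y)=(\gamma\eta)\cdot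 y$; (2) $r_Y(y)\cdot y=y$. $Y$ is a continuous left $G$-space if moreover $r_Y$ is open and $r_Y$ and the action map are continuous. The action is free if $\gamma\cdot y=y$ implies $\gamma=r_Y(y)$, and proper if $G*Y\to Y\times Y$, $(\gamma,y)\mapsto(\gamma\cdot y,y)$, is proper. Right actions are defined similarly with a map $s_Y$. For locally compact Hausdorff groupoids $G,H$, a $(G,H)$-equivalence is a locally compact Hausdorff space $Z$ that is a free and proper continuous left $G$-space and a free and proper continuous right $H$-space, such that the actions commute, $r_Z$ induces a homeomorphism $Z/H\to G^{(0)}$, and $s_Z$ induces a homeomorphism $G\backslash Z\to H^{(0)}$. $G$ and $H$ are equivalent if a $(G,H)$-equivalence exists. *)

(* Defs.v *)
From HB Require Import structures.
From mathcomp Require Import all_boot all_order all_algebra.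
From mathcomp Require Import generic_quotient.
From mathcomp Require Import boolp classical_sets functions cardinality.
From mathcomp Require Import topology.

Set Implicit Arguments.
Unset Strict Implicit.
Unset Printing Implicit Defensive.

Import GRing.Theory.

Local Open Scope classical_set_scope.

Definition homeomorphism (X Y : topologicalType) (f : X -> Y) : Prop :=
  continuous f /\
  exists g : Y -> X, [/\ continuous g, cancel f g & cancel g f].

Definition open_map (X Y : topologicalType) (f : X -> Y) : Prop :=
  forall U : set X, open U -> open (f @` U).

(* Properness of the restriction of [f] to the subspace [D]. *)
Definition proper_on (X Y : topologicalType) (D : set X) (f : X -> Y) : Prop :=
  forall K : set Y, compact K -> compact (D `&` f @^-1` K).

Definition lch_space (X : topologicalType) : Prop :=
  hausdorff_space X /\ locally_compact [set: X].

(* A groupoid is given by its arrows, the unit space being a subset of these.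
   [gmul] is total for convenience; [gmul g h] is only meaningful when
   [gs g = gr h]. No compatibility of the topology with the operations is
   required here: see [lch_groupoid]. *)
Record groupoid := Groupoid {
  garr :> topologicalType;
  gr : garr -> garr;
  gs : garr -> garr;
  gmul : garr -> garr -> garr;
  ginv : garr -> garr;
  gr_r : forall g, gr (gr g) = gr g;
  gs_r : forall g, gs (gr g) = gr g;
  gr_s : forall g, gr (gs g) = gs g;
  gs_s : forall g, gs (gs g) = gs g;
  gr_mul : forall g h, gs g = gr h -> gr (gmul g h) = gr g;
  gs_mul : forall g h, gs g = gr h -> gs (gmul g h) = gs h;
  gmulA : forall g h k, gs g = gr h -> gs h = gr k ->
    gmul g (gmul h k) = gmul (gmul g h) k;
  gmul_r : forall g, gmul (gr g) g = g;
  gmul_s : forall g, gmul g (gs g) = g;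
  gr_inv : forall g, gr (ginv g) = gs g;
  gs_inv : forall g, gs (ginv g) = gr g;
  gmulV : forall g, gmul g (ginv g) = gr g;
  gmulVg : forall g, gmul (ginv g) g = gs g
}.

Arguments gmul {g0} g h : rename.

Definition unit_set (G : groupoid) : set G := [set u | gr u = u].

(* [set_type] carries the subspace topology. *)
Definition unit_space (G : groupoid) : topologicalType :=
  set_type (@unit_set G).

Definition composable (G : groupoid) : set (G * G) :=
  [set p | gs p.1 = gr p.2].

Definition lch_groupoid (G : groupoid) : Prop :=
  [/\ lch_space G,
      {within @composable G, continuous (fun p : G * G => gmul p.1 p.2)} &
      continuous (@ginv G)].

Definition groupoid_isomorphism (G H : groupoid) (f : G -> H) : Prop :=
  [/\ bijective f,
      forall g, gr (f g) = f (gr g),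
      forall g, gs (f g) = f (gs g) &
      forall g h, gs g = gr h -> f (gmul g h) = gmul (f g) (f h)].

Definition isomorphic (G H : groupoid) : Prop :=
  exists f : G -> H, homeomorphism f /\ groupoid_isomorphism f.

Definition subgroupoid_closed (G : groupoid) (A : set G) : Prop :=
  (forall g, A g -> A (ginv g)) /\
  (forall g h, A g -> A h -> gs g = gr h -> A (gmul g h)).

Section Subgroupoid.
Variables (G : groupoid) (A : set G) (clA : subgroupoid_closed A).

Lemma sub_r_subproof (g : set_type A) : A (gr (\val g)).
Proof.
case: g => g /= /set_mem Ag; rewrite -gmulV.
by apply: clA.2 => //; [exact: clA.1 | rewrite gr_inv].
Qed.

Lemma sub_s_subproof (g : set_type A) : A (gs (\val g)).
Proof.
case: g => g /= /set_mem Ag; rewrite -gmulVg.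
by apply: clA.2 => //; [exact: clA.1 | rewrite gs_inv].
Qed.

Lemma sub_inv_subproof (g : set_type A) : A (ginv (\val g)).
Proof. by case: g => g /= /set_mem Ag; exact: clA.1. Qed.

Lemma sub_mul_subproof (g h : set_type A) :
  gs (\val g) = gr (\val h) -> A (gmul (\val g) (\val h)).
Proof.
by case: g h => [g /= /set_mem Ag] [h /= /set_mem Ah] gh; exact: clA.2.
Qed.

Definition sub_r (g : set_type A) : set_type A :=
  SigSub (mem_set (sub_r_subproof g)).
Definition sub_s (g : set_type A) : set_type A :=
  SigSub (mem_set (sub_s_subproof g)).
Definition sub_inv (g : set_type A) : set_type A :=
  SigSub (mem_set (sub_inv_subproof g)).
Definition sub_mul (g h : set_type A) : set_type A :=
  match pselect (gs (\val g) = gr (\val h)) with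
  | left gh => SigSub (mem_set (sub_mul_subproof gh))
  | right _ => g
  end.

Lemma val_sub_mul (g h : set_type A) : gs (\val g) = gr (\val h) ->
  \val (sub_mul g h) = gmul (\val g) (\val h).
Proof. by rewrite /sub_mul; case: pselect. Qed.

Lemma sub_compos (g h : set_type A) :
  sub_s g = sub_r h -> gs (\val g) = gr (\val h).
Proof. by move=> /(congr1 \val). Qed.

Lemma sub_eq (g h : set_type A) : \val g = \val h -> g = h.
Proof. exact: val_inj. Qed.

Program Definition subgroupoid : groupoid :=
  @Groupoid (set_type A) sub_r sub_s sub_mul sub_inv _ _ _ _ _ _ _ _ _ _ _ _ _.
Next Obligation. by move=> g; apply: sub_eq; rewrite /= gr_r. Qed.
Next Obligation. by move=> g; apply: sub_eq; rewrite /= gs_r. Qed.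
Next Obligation. by move=> g; apply: sub_eq; rewrite /= gr_s. Qed.
Next Obligation. by move=> g; apply: sub_eq; rewrite /= gs_s. Qed.
Next Obligation.
move=> g h /sub_compos gh; apply: sub_eq.
by rewrite /= val_sub_mul// gr_mul.
Qed.
Next Obligation.
move=> g h /sub_compos gh; apply: sub_eq.
by rewrite /= val_sub_mul// gs_mul.
Qed.
Next Obligation.
move=> g h k /sub_compos gh /sub_compos hk; apply: sub_eq.
rewrite !val_sub_mul ?gr_mul ?gs_mul//.
exact: gmulA.
Qed.
Next Obligation.
by move=> g; apply: sub_eq; rewrite val_sub_mul /= ?gmul_r// gs_r.
Qed.
Next Obligation.
by move=> g; apply: sub_eq; rewrite val_sub_mul /= ?gmul_s// gr_s.
Qed.
Next Obligation. by move=> g; apply: sub_eq; rewrite /= gr_inv. Qed.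
Next Obligation. by move=> g; apply: sub_eq; rewrite /= gs_inv. Qed.
Next Obligation.
by move=> g; apply: sub_eq; rewrite val_sub_mul /= ?gmulV// gr_inv.
Qed.
Next Obligation.
by move=> g; apply: sub_eq; rewrite val_sub_mul /= ?gmulVg// gs_inv.
Qed.

End Subgroupoid.

(* As for [gmul], the actions are total functions that are only meaningful on
   the fibred products [G * Y] and [Y * G]. *)
Record left_action (G : groupoid) (Y : topologicalType) := LeftAction {
  la_r : Y -> unit_space G;
  la_act : G -> Y -> Y;
  la_r_surj : forall u, exists y, la_r y = u;
  la_actM : forall g h y, gs h = \val (la_r y) -> gs g = gr h ->
    [/\ gs (gmul g h) = \val (la_r y),
        gs g = \val (la_r (la_act h y)) &
        la_act g (la_act h y) = la_act (gmul g h) y];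
  la_act1 : forall y, la_act (\val (la_r y)) y = y
}.

Record right_action (G : groupoid) (Y : topologicalType) := RightAction {
  ra_s : Y -> unit_space G;
  ra_act : Y -> G -> Y;
  ra_s_surj : forall u, exists y, ra_s y = u;
  ra_actM : forall y g h, \val (ra_s y) = gr g -> gs g = gr h ->
    [/\ \val (ra_s y) = gr (gmul g h),
        \val (ra_s (ra_act y g)) = gr h &
        ra_act (ra_act y g) h = ra_act y (gmul g h)];
  ra_act1 : forall y, ra_act y (\val (ra_s y)) = y
}.

Section LeftAction.
Local Open Scope quotient_scope.
Variables (G : groupoid) (Y : topologicalType) (a : left_action G Y).

Definition la_dom : set (G * Y) := [set p | gs p.1 = \val (la_r a p.2)].

Definition la_continuous : Prop :=
  [/\ open_map (la_r a), continuous (la_r a) &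
      {within la_dom, continuous (fun p : G * Y => la_act a p.1 p.2)}].

Definition la_free : Prop :=
  forall g y, la_dom (g, y) -> la_act a g y = y -> g = \val (la_r a y).

Definition la_proper : Prop :=
  proper_on la_dom (fun p : G * Y => (la_act a p.1 p.2, p.2)).

Definition la_orbit_rel : rel Y :=
  fun y z => `[< exists g, la_dom (g, y) /\ la_act a g y = z >].

Lemma la_orbit_equiv : equiv_class_of la_orbit_rel.
Proof.
have gs_unit (y : Y) : gs (\val (la_r a y)) = \val (la_r a y).
  by case: (la_r a y) => u /= /set_mem <-; rewrite gs_r.
have gr_unit (y : Y) : gr (\val (la_r a y)) = \val (la_r a y).
  by case: (la_r a y) => u /= /set_mem.
have symm (y z : Y) : la_orbit_rel y z -> la_orbit_rel z y.
  move=> /asboolP[g [gy <-]]; apply/asboolP; exists (ginv g).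
  have gg : gs (ginv g) = gr g by rewrite gs_inv.
  have [_ e2 e3] := la_actM gy gg; split=> //.
  rewrite e3 gmulVg.
  by move: gy => /= ->; exact: la_act1.
split=> [y|y z|z y t].
- by apply/asboolP; exists (\val (la_r a y)); split; [exact: gs_unit|exact: la_act1].
- by apply/idP/idP; exact: symm.
- move=> /asboolP[g [gy <-]] /asboolP[h [hgy <-]]; apply/asboolP.
  have hg : gs h = gr g.
    have [_ e2 _] : [/\ gs (gmul (gr g) g) = \val (la_r a y),
      gs (gr g) = \val (la_r a (la_act a g y)) &
      la_act a (gr g) (la_act a g y) = la_act a (gmul (gr g) g) y].
      by apply: la_actM => //; rewrite gs_r.
    by rewrite hgy /= -e2 gs_r.
  have [e1 _ e3] := la_actM gy hg.
  by exists (gmul h g); split.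
Qed.

Canonical la_orbit_equivRel := EquivRelPack la_orbit_equiv.

Definition la_orbit_space : topologicalType :=
  quotient_topology {eq_quot la_orbit_rel}.

Definition la_orbit (y : Y) : la_orbit_space := \pi_{eq_quot la_orbit_rel} y.

End LeftAction.

Section RightAction.
Local Open Scope quotient_scope.
Variables (G : groupoid) (Y : topologicalType) (a : right_action G Y).

Definition ra_dom : set (Y * G) := [set p | \val (ra_s a p.1) = gr p.2].

Definition ra_continuous : Prop :=
  [/\ open_map (ra_s a), continuous (ra_s a) &
      {within ra_dom, continuous (fun p : Y * G => ra_act a p.1 p.2)}].

Definition ra_free : Prop :=
  forall y g, ra_dom (y, g) -> ra_act a y g = y -> g = \val (ra_s a y).

Definition ra_proper : Prop :=
  proper_on ra_dom (fun p : Y * G => (ra_act a p.1 p.2, p.1)).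

Definition ra_orbit_rel : rel Y :=
  fun y z => `[< exists g, ra_dom (y, g) /\ ra_act a y g = z >].

Lemma ra_orbit_equiv : equiv_class_of ra_orbit_rel.
Proof.
have gr_unit (y : Y) : gr (\val (ra_s a y)) = \val (ra_s a y).
  by case: (ra_s a y) => u /= /set_mem.
have symm (y z : Y) : ra_orbit_rel y z -> ra_orbit_rel z y.
  move=> /asboolP[g [gy <-]]; apply/asboolP; exists (ginv g).
  have gg : gs g = gr (ginv g) by rewrite gr_inv.
  have [_ e2 e3] := ra_actM gy gg; split=> //.
  rewrite e3 gmulV.
  by move: gy => /= <-; exact: ra_act1.
split=> [y|y z|z y t].
- apply/asboolP; exists (\val (ra_s a y)); split; last exact: ra_act1.
  by rewrite /ra_dom /= gr_unit.
- by apply/idP/idP; exact: symm.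
- move=> /asboolP[g [gy <-]] /asboolP[h [hgy <-]]; apply/asboolP.
  have gh : gs g = gr h.
    have [_ e2 _] : [/\ \val (ra_s a y) = gr (gmul g (gs g)),
      \val (ra_s a (ra_act a y g)) = gr (gs g) &
      ra_act a (ra_act a y g) (gs g) = ra_act a y (gmul g (gs g))].
      by apply: ra_actM => //; rewrite gr_s.
    by rewrite -hgy /= e2 gr_s.
  have [e1 _ e3] := ra_actM gy gh.
  by exists (gmul g h); split.
Qed.

Canonical ra_orbit_equivRel := EquivRelPack ra_orbit_equiv.

Definition ra_orbit_space : topologicalType :=
  quotient_topology {eq_quot ra_orbit_rel}.

Definition ra_orbit (y : Y) : ra_orbit_space := \pi_{eq_quot ra_orbit_rel} y.

End RightAction.

(* The first two clauses say that both sides of the third one make sense. *)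
Definition actions_commute (G H : groupoid) (Z : topologicalType)
    (a : left_action G Z) (b : right_action H Z) : Prop :=
  [/\ forall g z, la_dom a (g, z) -> ra_s b (la_act a g z) = ra_s b z,
      forall z h, ra_dom b (z, h) -> la_r a (ra_act b z h) = la_r a z &
      forall g z h, la_dom a (g, z) -> ra_dom b (z, h) ->
        ra_act b (la_act a g z) h = la_act a g (ra_act b z h)].

Record groupoid_equivalence (G H : groupoid) (Z : topologicalType)
    (a : left_action G Z) (b : right_action H Z) : Prop := {
  ge_lch : lch_space Z;
  ge_left : [/\ la_continuous a, la_free a & la_proper a];
  ge_right : [/\ ra_continuous b, ra_free b & ra_proper b];
  ge_commute : actions_commute a b;
  ge_r : exists f : ra_orbit_space b -> unit_space G,
    homeomorphism f /\ forall z, f (ra_orbit b z) = la_r a z;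
  ge_s : exists f : la_orbit_space a -> unit_space H,
    homeomorphism f /\ forall z, f (la_orbit a z) = ra_s b z
}.

Definition equivalent (G H : groupoid) : Prop :=
  [/\ lch_groupoid G, lch_groupoid H &
      exists (Z : topologicalType) (a : left_action G Z) (b : right_action H Z),
        groupoid_equivalence a b].

Record digraph := Digraph {
  vert : Type;
  edge : Type;
  rng : edge -> vert;
  src : edge -> vert
}.

Section Paths.
Variable E : digraph.

Fixpoint walk (v : vert E) (p : seq (edge E)) : Prop :=
  if p is e :: q then rng e = v /\ walk (src e) q else True.

(* A finite path, possibly of length 0, with its range vertex. The edge [x_i]
   has index [i.-1] in [fedges x]. *)
Record finpath := FinPath {
  frng : vert E;
  fedges : seq (edge E);
  finpathP : walk frng fedges
}.

Definition flen (x : finpath) : nat := size (fedges x).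
Definition fsrc (x : finpath) : vert E := last (frng x) (map (@src E) (fedges x)).

(* An infinite path. The edge [x_i] is [x i.-1]. *)
Record infpath := InfPath {
  iedge :> nat -> edge E;
  infpathP : forall i, src (iedge i) = rng (iedge i.+1)
}.

Definition irng (x : infpath) : vert E := rng (x 0).

Variant gpath := GInf of infpath | GFin of finpath.

Definition prng (x : gpath) : vert E :=
  match x with GInf y => irng y | GFin y => frng y end.

Definition receives (v : vert E) : set (edge E) := [set e | rng e = v].
Definition emits (v : vert E) : set (edge E) := [set e | src e = v].

Definition is_source (v : vert E) : Prop := receives v = set0.
Definition infinite_receiver (v : vert E) : Prop := infinite_set (receives v).
Definition singular : set (vert E) :=
  [set v | is_source v \/ infinite_receiver v].

Definition reaches (v : vert E) (S : set (vert E)) : Prop :=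
  exists m : finpath, S (frng m) /\ fsrc m = v.

Definition acyclic : Prop := forall x : finpath, 0 < flen x -> frng x <> fsrc x.

(* No subpath [x_i ... x_j] is a cycle. *)
Definition acyclic_infpath (x : infpath) : Prop :=
  forall i j, i <= j -> rng (x i) <> src (x j).

Definition is_head (x : infpath) : Prop :=
  [/\ acyclic_infpath x,
      forall i, receives (rng (x i)) = [set x i] &
      forall i, emits (src (x i)) = [set x i]].

Definition boundary : set gpath := fun x =>
  match x with
  | GInf _ => True
  | GFin m => is_source (fsrc m) \/ infinite_receiver (fsrc m)
  end.

Lemma walk_cat v p q :
  walk v (p ++ q) <-> walk v p /\ walk (last v (map (@src E) p)) q.
Proof.
elim: p v => [|e p IH] v /=; first by split=> [|[]].
by rewrite IH; split=> [[? []]|[[]]].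
Qed.

Lemma fcat_subproof (a b : finpath) (ab : fsrc a = frng b) :
  walk (frng a) (fedges a ++ fedges b).
Proof.
by apply/walk_cat; split; [exact: finpathP | rewrite -/(fsrc a) ab; exact: finpathP].
Qed.

Definition fcat (a b : finpath) (ab : fsrc a = frng b) : finpath :=
  FinPath (fcat_subproof ab).

Fixpoint prepend (p : seq (edge E)) (x : nat -> edge E) : nat -> edge E :=
  if p is e :: q then fun i => if i is j.+1 then prepend q x j else e else x.

Lemma prepend0 (p : seq (edge E)) (x : infpath) v :
  walk v p -> last v (map (@src E) p) = irng x -> rng (prepend p x 0) = v.
Proof. by case: p => [|e p] /= => [_ ->|[]]. Qed.

Lemma icat_subproof (a : finpath) (x : infpath) (ax : fsrc a = irng x) (i : nat) :
  src (prepend (fedges a) x i) = rng (prepend (fedges a) x i.+1).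
Proof.
case: a ax => v p; rewrite /fsrc /= => wp ax.
elim: p v wp ax i => [|e p IH] v /=; first by move=> _ _ i; exact: infpathP.
move=> [_ wp] ax [|i]; last exact: IH wp ax i.
by rewrite (prepend0 wp ax).
Qed.

Definition icat (a : finpath) (x : infpath) (ax : fsrc a = irng x) : infpath :=
  InfPath (icat_subproof ax).

Definition pcat (a : finpath) (x : gpath) : fsrc a = prng x -> gpath :=
  match x return fsrc a = prng x -> gpath with
  | GInf y => fun ay => GInf (icat ay)
  | GFin y => fun ay => GFin (fcat ay)
  end.

Lemma finpath_eq (a b : finpath) :
  frng a = frng b -> fedges a = fedges b -> a = b.
Proof.
case: a b => [v p w] [v' p' w'] /= vv' pp'; subst v' p'.
by rewrite (Prop_irrelevance w w').
Qed.

Lemma infpath_eq (x y : infpath) : (x : nat -> edge E) =1 y -> x = y.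
Proof.
case: x y => [x xP] [y yP] /= /funext xy; subst y.
by rewrite (Prop_irrelevance xP yP).
Qed.

Lemma fsrc_fcat (a b : finpath) (ab : fsrc a = frng b) :
  fsrc (fcat ab) = fsrc b.
Proof. by rewrite /fsrc /= map_cat last_cat -/(fsrc a) ab. Qed.

Lemma prng_pcat (a : finpath) (x : gpath) (ax : fsrc a = prng x) :
  prng (pcat ax) = frng a.
Proof.
case: x ax => //= x ax.
by rewrite /irng /= (prepend0 (finpathP a)).
Qed.

Lemma pcatA (a b : finpath) (x : gpath) (ab : fsrc a = frng b)
    (bx : fsrc b = prng x) (abx : fsrc (fcat ab) = prng x)
    (abx' : fsrc a = prng (pcat bx)) : pcat abx = pcat abx'.
Proof.
case: x bx abx abx' => x /= bx abx abx'; congr (_ _).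
  by apply: infpath_eq => i /=; elim: (fedges a) i => [|e p IH] [|i] /=.
by apply: finpath_eq => //=; rewrite catA.
Qed.

Lemma cat_split (T : Type) (p q a b : seq T) : p ++ a = q ++ b ->
  size p <= size q -> exists2 d, q = p ++ d & a = d ++ b.
Proof.
elim: p q => [|e p IH] [|e' q] //=; first by move=> ->; exists [::].
  by move=> -> _; exists (e' :: q).
by move=> [<- /IH{}IH]; rewrite ltnS => /IH[d -> ->]; exists d.
Qed.

Lemma prepend_split (p q : seq (edge E)) (a b : nat -> edge E) :
  prepend p a =1 prepend q b ->
  size p <= size q -> exists2 d, q = p ++ d & a =1 prepend d b.
Proof.
elim: p q => [|e p IH] [|e' q] //=; first by exists [::].
  by move=> ab _; exists (e' :: q).
move=> ab; rewrite ltnS => pq.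
have [|d -> abd] := IH q _ pq; first by move=> i; exact: (ab i.+1).
by exists d => //; rewrite -(ab 0).
Qed.

Lemma pcat_split (b c : finpath) (x y : gpath)
    (bx : fsrc b = prng x) (cy : fsrc c = prng y) :
  pcat bx = pcat cy -> flen b <= flen c ->
  exists (d : finpath) (bd : fsrc b = frng d) (dy : fsrc d = prng y),
    c = fcat bd /\ x = pcat dy.
Proof.
move=> bxcy lebc.
have rbc : frng b = frng c by rewrite -(prng_pcat bx) bxcy prng_pcat.
suff [d cd xd] : exists2 d, fedges c = fedges b ++ d &
    forall w : walk (fsrc b) d, forall dy : fsrc (FinPath w) = prng y,
    x = pcat dy.
  have w : walk (fsrc b) d.
    by have := finpathP c; rewrite cd -rbc => /walk_cat[].
  have dy : fsrc (FinPath w) = prng y.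
    by rewrite -cy /fsrc /= cd map_cat last_cat rbc.
  exists (FinPath w), erefl, dy; split; last exact: xd.
  exact: finpath_eq.
case: x y bx cy bxcy => [x|x] [y|y] //= bx cy [].
  move=> bxcy.
  have [d cd xd] : exists2 d, fedges c = fedges b ++ d & x =1 prepend d y.
    by apply: prepend_split => // i; rewrite bxcy.
  by exists d => // w dy; congr GInf; exact: infpath_eq.
move=> _ bxcy.
have [d cd xd] := cat_split bxcy lebc.
by exists d => // w dy; congr GFin; apply: finpath_eq => //=.
Qed.

End Paths.

Arguments GInf {E}.
Arguments GFin {E}.

Section GraphGroupoid.
Variable E : digraph.

Local Open Scope ring_scope.

Definition in_GE (x : gpath E) (k : int) (y : gpath E) : Prop :=
  exists (a b : finpath E) (z : gpath E)
    (az : fsrc a = prng z) (bz : fsrc b = prng z),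
    [/\ boundary z, x = pcat az, k = (flen a)%:Z - (flen b)%:Z & y = pcat bz].

Record garrow := GArrow {
  ga_r : gpath E;
  ga_deg : int;
  ga_s : gpath E;
  ga_mem : in_GE ga_r ga_deg ga_s
}.

Lemma garrow_eq (g h : garrow) :
  ga_r g = ga_r h -> ga_deg g = ga_deg h -> ga_s g = ga_s h -> g = h.
Proof.
case: g h => [x k y w] [x' k' y' w'] /= xx' kk' yy'; subst x' k' y'.
by rewrite (Prop_irrelevance w w').
Qed.

HB.instance Definition _ := gen_eqMixin garrow.
HB.instance Definition _ := gen_choiceMixin garrow.

(* [Z(a, b)], which is empty unless [fsrc a = fsrc b]. *)
Definition cylinder (a b : finpath E) : set garrow :=
  [set g | exists (x : gpath E) (ax : fsrc a = prng x) (bx : fsrc b = prng x),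
    [/\ boundary x, ga_r g = pcat ax,
        ga_deg g = (flen a)%:Z - (flen b)%:Z & ga_s g = pcat bx]].

Definition cylinderD (a b : finpath E) (K : set (finpath E)) : set garrow :=
  cylinder a b `\`
  [set g | exists (c : finpath E) (ac : fsrc a = frng c) (bc : fsrc b = frng c),
    K c /\ cylinder (fcat ac) (fcat bc) g].

Definition basic_open : set (set garrow) :=
  [set U | exists (a b : finpath E) (K : set (finpath E)),
    [/\ fsrc a = fsrc b, finite_set K, (forall c, K c -> frng c = fsrc a) &
        U = cylinderD a b K]].

(* The topology generated by the sets [Z((a, b) \ K)]; as these form a basis,
   there is no difference between using them as a basis and as a subbasis. *)
HB.instance Definition _ :=
  @isSubBaseTopological.Build garrow (set garrow) basic_open id.

Lemma in_GE_sym x k y : in_GE x k y -> in_GE y (- k) x.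
Proof.
move=> [a [b [z [az [bz [Xz -> -> ->]]]]]].
by exists b, a, z, bz, az; split=> //; rewrite opprB.
Qed.

Lemma in_GE_unit x k y : in_GE x k y -> in_GE x 0 x.
Proof.
move=> [a [_ [z [az [_ [Xz -> _ _]]]]]].
by exists a, a, z, az, az; split=> //; rewrite subrr.
Qed.

Lemma in_GE_trans x k y l z : in_GE x k y -> in_GE y l z -> in_GE x (k + l) z.
Proof.
wlog suff aux : x k y l z / forall a b c d (u v : gpath E)
    (au : fsrc a = prng u) (bu : fsrc b = prng u)
    (cv : fsrc c = prng v) (dv : fsrc d = prng v),
    boundary v -> pcat bu = pcat cv -> (flen b <= flen c)%N ->
    in_GE (pcat au) ((flen a)%:Z - (flen b)%:Z + ((flen c)%:Z - (flen d)%:Z))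
      (pcat dv).
  move=> [a [b [u [au [bu [Xu -> -> ->]]]]]].
  move=> [c [d [v [cv [dv [Xv bc -> ->]]]]]].
  have [lebc|/ltnW lecb] := leqP (flen b) (flen c); first exact: aux.
  rewrite -[X in in_GE _ X _]opprK; apply: in_GE_sym.
  by rewrite opprD !opprB addrC; exact: aux.
move=> a b c d u v au bu cv dv Xv bc lebc.
have [e [be [ev [ce uev]]]] := pcat_split bc lebc.
subst u.
have ae : fsrc a = frng e by rewrite au prng_pcat.
have aev : fsrc (fcat ae) = prng v by rewrite fsrc_fcat.
exists (fcat ae), d, v, aev, dv; split=> //; first by rewrite (pcatA aev au).
rewrite ce /flen /= !size_cat !PoszD.
by rewrite -!addrA addKr.
Qed.

Definition ga_rng (g : garrow) : garrow := GArrow (in_GE_unit (ga_mem g)).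
Definition ga_src (g : garrow) : garrow :=
  GArrow (in_GE_unit (in_GE_sym (ga_mem g))).
Definition ga_inv (g : garrow) : garrow := GArrow (in_GE_sym (ga_mem g)).

Lemma ga_mul_subproof (g h : garrow) :
  ga_s g = ga_r h -> in_GE (ga_r g) (ga_deg g + ga_deg h) (ga_s h).
Proof.
move=> gh; apply: in_GE_trans (ga_mem g) _.
by rewrite gh; exact: ga_mem.
Qed.

Definition ga_mul (g h : garrow) : garrow :=
  match pselect (ga_s g = ga_r h) with
  | left gh => GArrow (ga_mul_subproof gh)
  | right _ => g
  end.

Lemma ga_mulE (g h : garrow) : ga_s g = ga_r h ->
  [/\ ga_r (ga_mul g h) = ga_r g, ga_s (ga_mul g h) = ga_s h &
      ga_deg (ga_mul g h) = ga_deg g + ga_deg h].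
Proof. by rewrite /ga_mul; case: pselect. Qed.

Lemma ga_compos (g h : garrow) : ga_src g = ga_rng h -> ga_s g = ga_r h.
Proof. by move=> /(congr1 ga_r). Qed.

Program Definition graph_groupoid : groupoid :=
  @Groupoid garrow ga_rng ga_src ga_mul ga_inv _ _ _ _ _ _ _ _ _ _ _ _ _.
Next Obligation. by move=> g; exact: garrow_eq. Qed.
Next Obligation. by move=> g; exact: garrow_eq. Qed.
Next Obligation. by move=> g; exact: garrow_eq. Qed.
Next Obligation. by move=> g; exact: garrow_eq. Qed.
Next Obligation.
by move=> g h /ga_compos /ga_mulE[? ? ?]; exact: garrow_eq.
Qed.
Next Obligation.
by move=> g h /ga_compos /ga_mulE[? ? ?]; exact: garrow_eq.
Qed.
Next Obligation.
move=> g h k /ga_compos gh /ga_compos hk.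
have [r1 s1 d1] := ga_mulE gh; have [r2 s2 d2] := ga_mulE hk.
have [|r3 s3 d3] := @ga_mulE g (ga_mul h k); first by rewrite r2.
have [|r4 s4 d4] := @ga_mulE (ga_mul g h) k; first by rewrite s1.
by apply: garrow_eq; rewrite ?r3 ?s3 ?d3 ?r4 ?s4 ?d4 ?r1 ?d1 ?s2 ?d2 ?addrA.
Qed.
Next Obligation.
move=> g; have [//|r s d] := @ga_mulE (ga_rng g) g.
by apply: garrow_eq => //; rewrite d add0r.
Qed.
Next Obligation.
move=> g; have [//|r s d] := @ga_mulE g (ga_src g).
by apply: garrow_eq => //; rewrite d addr0.
Qed.
Next Obligation. by move=> g; exact: garrow_eq. Qed.
Next Obligation. by move=> g; exact: garrow_eq. Qed.
Next Obligation.
move=> g; have [//|r s d] := @ga_mulE g (ga_inv g).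
by apply: garrow_eq => //; rewrite d subrr.
Qed.
Next Obligation.
move=> g; have [//|r s d] := @ga_mulE (ga_inv g) g.
by apply: garrow_eq => //; rewrite d addNr.
Qed.

Definition pointed_set (S : set (vert E)) : set graph_groupoid :=
  [set g | exists (a b : finpath E) (x : gpath E)
      (ax : fsrc a = prng x) (bx : fsrc b = prng x),
    [/\ boundary x, S (frng a), S (frng b) &
     [/\ ga_r g = pcat ax, ga_deg g = (flen a)%:Z - (flen b)%:Z &
        ga_s g = pcat bx]]].

Lemma pointed_setE (S : set (vert E)) (g : garrow) :
  pointed_set S g <-> S (prng (ga_r g)) /\ S (prng (ga_s g)).
Proof.
split=> [[a [b [x [ax [bx [_ Sa Sb [-> _ ->]]]]]]]|].
  by rewrite !prng_pcat.
case: g => r k s; case=> [a [b [x [ax [bx [Xx er ek es]]]]]] [].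
subst r k s => /=; rewrite !prng_pcat => Sa Sb.
by exists a, b, x, ax, bx; split.
Qed.

Lemma pointed_closed (S : set (vert E)) : subgroupoid_closed (pointed_set S).
Proof.
split=> [g /pointed_setE[? ?]|g h]; first exact/pointed_setE.
move=> /pointed_setE[rg sg] /pointed_setE[rh sh] /ga_compos gh.
by apply/pointed_setE; have [/= -> -> _] := ga_mulE gh.
Qed.

Definition pointed_groupoid (S : set (vert E)) : groupoid :=
  subgroupoid (pointed_closed S).

End GraphGroupoid.

Section Contraction.
Variables (E : digraph) (A : set (vert E)).

(* The subgraph [T] with vertices [E^0 \ A] and all edges between them. *)
Definition complement_graph : digraph := {|
  vert := {v : vert E | ~ A v};
  edge := {e : edge E | ~ A (rng e) /\ ~ A (src e)};
  rng := fun e => exist _ (rng (sval e)) (svalP e).1;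
  src := fun e => exist _ (src (sval e)) (svalP e).2 |}.

(* The edge [e] at index [i] of [b] is its [i.+1]-st one: all edges of [b] but the
   last must have their source outside [A]. *)
Definition contracted_path (b : finpath E) : Prop :=
  [/\ 0 < flen b, A (fsrc b), A (frng b) &
      forall i e, i.+1 < flen b -> onth (fedges b) i = Some e -> ~ A (src e)].

Lemma contracted_rng (b : finpath E) : contracted_path b -> A (frng b).
Proof. by case. Qed.

Lemma contracted_src (b : finpath E) : contracted_path b -> A (fsrc b).
Proof. by case. Qed.

Definition contracted_graph : digraph := {|
  vert := {v : vert E | A v};
  edge := {b : finpath E | contracted_path b};
  rng := fun b => exist _ (frng (sval b)) (contracted_rng (svalP b));
  src := fun b => exist _ (fsrc (sval b)) (contracted_src (svalP b)) |}.

End Contraction.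

(* Main.v *)
(* A path of [F] flattens to a path of [E], and a boundary path [z] of [E] that
   starts in [F0] determines the path [x] of [F] whose finite prefixes are those
   that flatten to prefixes of [z]. This is a bijection of boundary paths. The
   delicate case is that of a [z] that ends with an infinite path leaving a
   vertex [v] of [F0] and never returning: (T1) makes this path the only one at
   [v], (T4) prevents [v] from being itself a boundary path of [E], and the
   absence of heads makes [v] an infinite receiver of [F], so that [x] is a
   finite boundary path; Konig's lemma gives the converse. On arrows, (T3) lets
   one write every element of [G] as [(flat p u, k, flat q u)] with [u] starting
   in [F0]. The resulting bijection [G -> G_F] pulls [Z(p, q)] back to
   [Z(flat p, flat q)], so it is continuous, and open by compactness of the
   cylinders. The equivalence holds because [G] is the reduction of [G_E] to a
   clopen set of units, which by (T2) meets every orbit; the elements of [G_E]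
   with range in this set form an equivalence. *)
From HB Require Import structures.
Require Import Defs.
From mathcomp Require Import all_boot all_order all_algebra generic_quotient.
From mathcomp Require Import boolp classical_sets functions cardinality filter.
From mathcomp Require Import topology zify.

Set Implicit Arguments.
Unset Strict Implicit.
Unset Printing Implicit Defensive.

Import GRing.Theory.

Local Open Scope classical_set_scope.
Local Open Scope card_scope.

(** * Prefixes and limits of paths *)

Section Concatenation.
Variable E : digraph.
Implicit Types (a b c d : finpath E) (x y z : gpath E).

(** A boundary path is handled through the set of its finite prefixes, and an arrow through the set
    of cylinders containing it; each is determined by this set. So the passage between paths of [E]
    and of [F] is a relation between prefixes, [flat_rel], and infinite paths are never flattened
    explicitly. It is well behaved because contracted paths form a prefix code: none is a proper
    prefix of another, so flattening reflects the prefix order. The obstacle on arrows is that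
    flattening changes lengths: the degree of an arrow of [G_F] is not determined by the degree in
    [G], and is read off a pair of paths shared by the two arrows. The obstacle for the topology is
    that the paths of a cylinder of [E] need not end in [F0], so openness of the bijection is not
    visible on basic sets. *)

Definition vpath (v : vert E) : finpath E := @FinPath E v [::] I.
Definition epath (e : edge E) : finpath E :=
  @FinPath E (rng e) [:: e] (conj erefl I).

(* Junk values [a] and [x] when the paths are not composable. *)
Definition fapp a b : finpath E :=
  if pselect (fsrc a = frng b) is left h then fcat h else a.
Definition papp a x : gpath E :=
  if pselect (fsrc a = prng x) is left h then pcat h else x.

Lemma fappE a b (h : fsrc a = frng b) : fapp a b = fcat h.
Proof. by rewrite /fapp; case: pselect => // h'; exact: finpath_eq. Qed.

Lemma pappE a x (h : fsrc a = prng x) : papp a x = pcat h.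
Proof. by rewrite /papp; case: pselect => // h'; rewrite (Prop_irrelevance h h'). Qed.

Lemma frng_fapp a b : frng (fapp a b) = frng a.
Proof. by rewrite /fapp; case: pselect. Qed.

Lemma fedges_fapp a b : fsrc a = frng b ->
  fedges (fapp a b) = fedges a ++ fedges b.
Proof. by move=> h; rewrite (fappE h). Qed.

Lemma flen_fapp a b : fsrc a = frng b -> flen (fapp a b) = flen a + flen b.
Proof. by move=> h; rewrite /flen fedges_fapp// size_cat. Qed.

Lemma fsrc_fapp a b : fsrc a = frng b -> fsrc (fapp a b) = fsrc b.
Proof. by move=> h; rewrite (fappE h) fsrc_fcat. Qed.

Lemma prng_papp a x : fsrc a = prng x -> prng (papp a x) = frng a.
Proof. by move=> h; rewrite (pappE h) prng_pcat. Qed.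

Lemma fappA a b c : fsrc a = frng b -> fsrc b = frng c ->
  fapp (fapp a b) c = fapp a (fapp b c).
Proof.
move=> ab bc; apply: finpath_eq; first by rewrite !frng_fapp.
by rewrite !fedges_fapp ?catA ?fsrc_fapp ?frng_fapp.
Qed.

Lemma pappA a b x : fsrc a = frng b -> fsrc b = prng x ->
  papp (fapp a b) x = papp a (papp b x).
Proof.
move=> ab bx; have abx : fsrc (fcat ab) = prng x by rewrite fsrc_fcat.
have abx' : fsrc a = prng (pcat bx) by rewrite prng_pcat.
by rewrite (fappE ab) (pappE abx) (pappE bx) (pappE abx') (pcatA _ abx').
Qed.

Lemma fapp_vpath a : fapp a (vpath (fsrc a)) = a.
Proof. by apply: finpath_eq; rewrite ?frng_fapp// fedges_fapp// cats0. Qed.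

Lemma vpath_fapp a : fapp (vpath (frng a)) a = a.
Proof. by apply: finpath_eq; rewrite ?frng_fapp// fedges_fapp. Qed.

Lemma flen0 a : flen a = 0 -> a = vpath (frng a).
Proof. by move=> /size0nil h; exact: finpath_eq. Qed.

Lemma vpath_papp x : papp (vpath (prng x)) x = x.
Proof.
rewrite (@pappE _ _ (erefl : fsrc (vpath _) = prng x)).
by case: x => x /=; congr (_ _); [exact: infpath_eq|exact: finpath_eq].
Qed.

Lemma papp_fin a b : fsrc a = frng b -> papp a (GFin b) = GFin (fapp a b).
Proof. by move=> h; rewrite (fappE h) (@pappE a (GFin b) h). Qed.

Lemma papp_split b c x y : fsrc b = prng x -> fsrc c = prng y ->
  papp b x = papp c y -> flen b <= flen c ->
  exists d, [/\ fsrc b = frng d, fsrc d = prng y, c = fapp b d & x = papp d y].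
Proof.
move=> bx cy; rewrite (pappE bx) (pappE cy) => e le.
have [d [bd [dy [-> ->]]]] := pcat_split e le.
by exists d; rewrite (fappE bd) (pappE dy).
Qed.

Lemma fapp_inj b c d : fsrc b = frng c -> fsrc b = frng d ->
  fapp b c = fapp b d -> c = d.
Proof.
move=> bc bd /(congr1 (@fedges E)); rewrite !fedges_fapp//.
by move=> /(congr1 (drop (flen b))); rewrite !drop_size_cat// => ?;
  apply: finpath_eq => //; rewrite -bc.
Qed.

Lemma papp_inj b x y : fsrc b = prng x -> fsrc b = prng y ->
  papp b x = papp b y -> x = y.
Proof.
move=> bx bY e; have [d [bd dy bb ->]] := papp_split bx bY e (leqnn _).
have -> : d = vpath (prng y).
  by apply: (fapp_inj bd) => //; rewrite -bb -bY fapp_vpath.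
exact: vpath_papp.
Qed.

Lemma boundary_papp a x : fsrc a = prng x -> boundary (papp a x) = boundary x.
Proof.
move=> h; case: x h => x h; first by rewrite (pappE h).
by rewrite papp_fin//= fsrc_fapp.
Qed.

Lemma papp_epath_inf (y : infpath E) :
  exists y' : infpath E, src (y 0) = prng (GInf y') /\
    GInf y = papp (epath (y 0)) (GInf y') /\ forall i, y' i = y i.+1.
Proof.
exists (@InfPath E (fun i => y i.+1) (fun i => infpathP y i.+1)).
have h : fsrc (epath (y 0)) = prng (GInf
  (@InfPath E (fun i => y i.+1) (fun i => infpathP y i.+1))).
  exact: (infpathP y 0).
by split=> //; split=> //; rewrite (pappE h) /=; congr GInf;
  apply: infpath_eq => -[|i].
Qed.

Lemma finpath_first a : 0 < flen a ->
  exists e b, src e = frng b /\ a = fapp (epath e) b.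
Proof.
case: a => v [//|e p] w _; exists e; have [/= re wp] := w.
exists (FinPath wp); split=> //; apply: finpath_eq => /=.
  by rewrite frng_fapp.
by rewrite fedges_fapp.
Qed.

Lemma finpath_last a : 0 < flen a ->
  exists b e, fsrc b = rng e /\ a = fapp b (epath e).
Proof.
case: a => v p w; rewrite /flen /=; elim/last_ind: p w => [//|p e _] w _.
have : walk v (p ++ [:: e]) by rewrite cats1.
move=> /walk_cat[wp [re _]].
exists (FinPath wp), e; split; [exact/esym|apply: finpath_eq => /=].
  by rewrite frng_fapp.
by rewrite fedges_fapp ?cats1.
Qed.

Lemma gpath_first x : x = GFin (vpath (prng x)) \/
  exists e y, src e = prng y /\ x = papp (epath e) y.
Proof.
case: x => [x|a].
  by right; have [y [? [? _]]] := papp_epath_inf x; exists (x 0), (GInf y).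
have [/flen0 ->|] := posnP (flen a); first by left.
move=> /finpath_first[e [b [eb ->]]]; right; exists e, (GFin b).
by rewrite papp_fin.
Qed.

(** * Prefixes, and paths determined by their prefixes *)

Definition pfx a x := exists y, fsrc a = prng y /\ x = papp a y.
Definition fpfx a b := exists d, fsrc a = frng d /\ b = fapp a d.

Lemma pfx_papp a x : fsrc a = prng x -> pfx a (papp a x).
Proof. by exists x. Qed.

Lemma pfx_rng a x : pfx a x -> frng a = prng x.
Proof. by move=> [y [? ->]]; rewrite prng_papp. Qed.

Lemma pfx_vpath v x : pfx (vpath v) x <-> v = prng x.
Proof.
split=> [/pfx_rng//|->]; exists x; split=> //.
by rewrite vpath_papp.
Qed.

Lemma pfx_trans a d x : fsrc a = frng d -> pfx (fapp a d) x -> pfx a x.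
Proof.
move=> ad [y []]; rewrite fsrc_fapp// => dy ->.
by exists (papp d y); rewrite prng_papp// pappA.
Qed.

Lemma fpfx_pfx a b x : fpfx a b -> pfx b x -> pfx a x.
Proof. by move=> [d [ad ->]]; exact: pfx_trans. Qed.

Lemma fpfx_fapp a d : fsrc a = frng d -> fpfx a (fapp a d).
Proof. by exists d. Qed.

Lemma fpfx_refl a : fpfx a a.
Proof. by exists (vpath (fsrc a)); rewrite fapp_vpath. Qed.

Lemma fpfx_trans b a c : fpfx a b -> fpfx b c -> fpfx a c.
Proof.
move=> [d [ad ->]] [d' []]; rewrite fsrc_fapp// => dd' ->.
by exists (fapp d d'); rewrite frng_fapp fappA.
Qed.

Lemma fpfx_len a b : fpfx a b -> flen a <= flen b.
Proof. by move=> [d [ad ->]]; rewrite flen_fapp// leq_addr. Qed.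

Lemma fpfx_eq a b : fpfx a b -> flen b <= flen a -> a = b.
Proof.
move=> [d [ad ->]]; rewrite flen_fapp// -[X in _ <= X]addn0 leq_add2l leqn0.
by move=> /eqP/flen0 ->; rewrite -ad fapp_vpath.
Qed.

Lemma pfx_fin a b : pfx a (GFin b) <-> fpfx a b.
Proof.
split=> [[y [ay]]|[d [ad ->]]]; last by exists (GFin d); rewrite papp_fin.
by case: y ay => [y|d] ay; rewrite (pappE ay)// => -[->]; exists d; rewrite (fappE ay).
Qed.

Lemma pfx_comparable a b x : pfx a x -> pfx b x -> flen a <= flen b -> fpfx a b.
Proof.
move=> [y [ay ->]] [y' [bY e]] /(papp_split ay bY e)[d [? ? ? ?]].
by exists d.
Qed.

Lemma pfx_papp2 a d x : fsrc a = frng d -> fsrc a = prng x ->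
  pfx (fapp a d) (papp a x) <-> pfx d x.
Proof.
move=> ad ax; split=> [[y []]|[y [dy ->]]].
  rewrite fsrc_fapp// => dy; rewrite pappA// => /papp_inj ->//.
    exact: pfx_papp.
  by rewrite prng_papp.
by exists y; rewrite fsrc_fapp// pappA.
Qed.

Lemma pfx_step a x : pfx a x -> x = GFin a \/
  exists e, fsrc a = rng e /\ pfx (fapp a (epath e)) x.
Proof.
move=> [y [ay ->]]; have [->|[e [z [ez yE]]]] := gpath_first y.
  by left; rewrite papp_fin//= -ay fapp_vpath.
have aE : fsrc a = rng e by rewrite ay yE prng_papp.
right; exists e; split=> //; apply/pfx_papp2 => //.
by rewrite yE; exact: pfx_papp.
Qed.

Definition pedge x : nat -> option (edge E) :=
  match x with GInf y => fun i => Some (y i) | GFin a => onth (fedges a) end.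

Lemma pedge_papp a x i : fsrc a = prng x ->
  pedge (papp a x) i =
  if i < flen a then onth (fedges a) i else pedge x (i - flen a).
Proof.
move=> h; rewrite (pappE h); case: x h => [x|b] h /=; last first.
  by rewrite onth_cat.
rewrite /flen; elim: (fedges a) i => [|e p IH] [|i] //=.
Qed.

Lemma pedge_pfx a x i : pfx a x -> i < flen a -> pedge x i = onth (fedges a) i.
Proof. by move=> [y [ay ->]] ia; rewrite pedge_papp// ia. Qed.

Lemma onth_some (T : Type) (s : seq T) i : i < size s -> exists e, onth s i = Some e.
Proof. by rewrite -onthTE; case: onth => // e; exists e. Qed.

Lemma onth_size (T : Type) (s : seq T) i e : onth s i = Some e -> i < size s.
Proof. by rewrite -onthTE => ->. Qed.

Lemma gpath_eq x y : prng x = prng y -> pedge x =1 pedge y -> x = y.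
Proof.
case: x y => [x|a] [y|b] /= r.
- by move=> h; congr GInf; apply: infpath_eq => i; have [] := h i.
- by move=> h; have := onth_size (esym (h (flen b))); rewrite ltnn.
- by move=> h; have := onth_size (h (flen a)); rewrite ltnn.
move=> h; congr GFin; apply: finpath_eq => //.
by apply: eq_from_onth_le => i _; exact: h.
Qed.

Lemma pfx_take x i e : pedge x i = Some e ->
  exists a, [/\ pfx a x, flen a = i.+1 & onth (fedges a) i = Some e].
Proof.
elim: i x e => [|i IH] x e.
  have [->|[e' [y [ey ->]]]] := gpath_first x; first by [].
  rewrite pedge_papp//= => -[<-].
  by exists (epath e'); split=> //; exact: pfx_papp.
have [->|[e' [y [ey ->]]]] := gpath_first x; first by [].
rewrite pedge_papp//= subn1 => /IH[a [ay la oa]].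
have ea : src e' = frng a by rewrite (pfx_rng ay).
exists (fapp (epath e') a); split.
- exact/pfx_papp2.
- by rewrite flen_fapp// la.
- by rewrite fedges_fapp.
Qed.

(** Edge [i] is the last edge of a prefix of length [i.+1], so equal sets of prefixes force equal
    edges and equal lengths. *)
Lemma pfx_ext x y : (forall a, pfx a x <-> pfx a y) -> x = y.
Proof.
move=> h; have r : prng x = prng y.
  by have /pfx_vpath := (h (vpath (prng x))).1 ((pfx_vpath _ _).2 erefl).
have aux : forall x y i e, (forall a, pfx a x <-> pfx a y) ->
    pedge x i = Some e -> pedge y i = Some e.
  move=> {r h}{}x {}y i e h /pfx_take[a [/h ay la <-]].
  by rewrite (pedge_pfx ay)// la.
apply: gpath_eq => // i; case e1 : (pedge x i) => [e|].
  by rewrite (aux _ _ _ _ h e1).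
case e2 : (pedge y i) => [e|] //.
by rewrite -e1; apply: aux e2 => a; rewrite h.
Qed.

Lemma walk_onth v (p : seq (edge E)) i e e' : walk v p -> onth p i = Some e ->
  onth p i.+1 = Some e' -> src e = rng e'.
Proof.
elim: p v i => [|f p IH] v [|i] //= [_ wp]; last exact: IH wp.
by move=> [<-]; case: p wp {IH} => //= f' p [<- _] [<-].
Qed.

(* All limits of paths below are built by this lemma, which spares separate
   treatments of the finite and the infinite case. *)
Lemma chain_gpath (P : set (finpath E)) : P !=set0 ->
  (forall a b, fpfx a b -> P b -> P a) ->
  (forall a b, P a -> P b -> flen a <= flen b -> fpfx a b) ->
  exists x, forall a, P a <-> pfx a x.
Proof.
move=> [a0 Pa0] Pc Pt.
(* If lengths are bounded, a longest member is the limit; otherwise the limit is infinite, and its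
   edge [n] is read from any member longer than [n]. *)
have [[m Pm]|unb] := pselect (exists m, forall a, P a -> flen a <= m).
  have [a [Pa amax]] : exists a, P a /\ forall b, P b -> flen b <= flen a.
    have [n] := ubnP (m - flen a0); elim: n a0 Pa0 => // n IH a0 Pa0 lt.
    have [//|] := pselect (forall b, P b -> flen b <= flen a0); first by exists a0.
    move=> /existsNP[b /not_implyP[Pb /negP]]; rewrite -ltnNge => lb.
    apply: (IH b Pb); move: lt; rewrite !ltnS => /(leq_trans _); apply.
    by rewrite ltn_sub2l// (leq_trans lb)// Pm.
  exists (GFin a) => b; split=> [Pb|/pfx_fin/Pc]; last exact.
  exact/pfx_fin/(Pt _ _ Pb Pa)/amax.
have ex n : exists a, P a /\ n < flen a.
  apply: contrapT => h; apply: unb; exists n => a Pa.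
  by rewrite leqNgt; apply/negP => lt; apply: h; exists a.
have exe n : exists e, exists a, P a /\ onth (fedges a) n = Some e.
  by have [a [Pa /onth_some[e ae]]] := ex n; exists e, a.
(* Members are comparable, so the edge at [n] does not depend on the member and the choice [f] below
   is coherent. *)
have cst a b n e : P a -> P b -> onth (fedges a) n = Some e -> n < flen b ->
    onth (fedges b) n = Some e.
  move=> Pa Pb ae nb; have na := onth_size ae.
  have [/(Pt _ _ Pa Pb)|/ltnW/(Pt _ _ Pb Pa)] := leqP (flen a) (flen b).
    by move=> /pfx_fin/pedge_pfx/(_ na) /= ->.
  by move=> /pfx_fin/pedge_pfx/(_ nb) /= <-.
have [f fP] := choice exe.
have fP' a n : P a -> n < flen a -> onth (fedges a) n = Some (f n).
  by move=> Pa na; have [b [Pb be]] := fP n; exact: cst be na.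
have fw i : src (f i) = rng (f i.+1).
  have [a [Pa ia]] := ex i.+1.
  by apply: (walk_onth (finpathP a)); apply: fP' => //; exact: ltnW.
pose x := GInf (InfPath fw).
have rx a : P a -> frng a = prng x.
  move=> Pa; have [b [Pb lb]] := ex (flen a).
  have [d [ad be]] := Pt _ _ Pa Pb (ltnW lb).
  have := fP' b 0 Pb (leq_ltn_trans (leq0n _) lb); rewrite -(frng_fapp a d) -be.
  rewrite /x /= /irng /=; case: b {Pb lb be} => v [|e p] //= [<- _].
  by move=> [<-].
have Px a : P a -> pfx a x.
  move=> Pa.
  have tw i : src (f (flen a + i)) = rng (f (flen a + i.+1)) by rewrite addnS.
  pose y := GInf (InfPath tw).
  have ay : fsrc a = prng y.
    have [b [Pb lb]] := ex (flen a).
    have [d [ad be]] := Pt _ _ Pa Pb (ltnW lb).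
    have := fP' b _ Pb lb; rewrite be fedges_fapp// onth_cat.
    rewrite ltnn subnn ad /y /= /irng /= addn0.
    have : 0 < flen d by rewrite be flen_fapp// -addn1 leq_add2l in lb.
    by case: d {ad be} => v [|e p] //= [re _] _ [<-].
  exists y; split=> //; apply: gpath_eq; first by rewrite prng_papp// rx.
  move=> i; rewrite pedge_papp// /=; case: ltnP => ia.
    by rewrite fP'.
  by rewrite subnKC.
exists x => a; split=> [/Px//|ax]; have [b [Pb lb]] := ex (flen a).
by apply: (Pc _ _ (pfx_comparable ax (Px _ Pb) (ltnW lb))) Pb.
Qed.

(** The step [f] is allowed to stall, and then the limit is finite; a construction that may or may
    not stop is thus treated at once. *)
Lemma iter_gpath (f : finpath E -> finpath E) (a0 : finpath E) :
  (forall a, fpfx a (f a)) ->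
  exists x, forall a, pfx a x <-> exists n, fpfx a (iter n f a0).
Proof.
move=> fE.
have mono m n : m <= n -> fpfx (iter m f a0) (iter n f a0).
  move=> /subnK <-; elim: (n - m) => [|k IH]; first exact: fpfx_refl.
  by rewrite addSn iterS; apply: fpfx_trans IH (fE _).
have [| | |x xP] := @chain_gpath [set a | exists n, fpfx a (iter n f a0)].
- by exists a0; exists 0; exact: fpfx_refl.
- by move=> a b ab [n bn]; exists n; exact: fpfx_trans bn.
- move=> a b [m am] [n bn] le; pose k := maxn m n.
  have ak : pfx a (GFin (iter k f a0)).
    by apply/pfx_fin/(fpfx_trans am)/mono; exact: leq_maxl.
  apply: (pfx_comparable ak _ le).
  by apply/pfx_fin/(fpfx_trans bn)/mono; exact: leq_maxr.
by exists x => a; rewrite -xP.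
Qed.

(** Edges are added until a source is met. A finite limit is itself an iterate that the next step
    does not lengthen, which happens only at a singular vertex. *)
Lemma boundary_exists (v : vert E) : exists x, boundary x /\ prng x = v.
Proof.
have step a : exists b, fpfx a b /\
    ((is_source (fsrc a) \/ infinite_receiver (fsrc a)) \/ flen a < flen b).
  have [s|s] := pselect (is_source (fsrc a)).
    by exists a; split; [exact: fpfx_refl|left; left].
  have /set0P[e re] : receives (fsrc a) != set0 by apply/eqP.
  exists (fapp a (epath e)); split; first exact: fpfx_fapp.
  by right; rewrite flen_fapp// addn1.
have [f fP] := choice step.
have [x xP] := iter_gpath (vpath v) (fun a => (fP a).1).
exists x; split; last first.
  by apply/esym/pfx_vpath/xP; exists 0; exact: fpfx_refl.
case: x xP => // a aP /=.
have [n an] := (aP a).1 ((pfx_fin _ _).2 (fpfx_refl _)).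
have /pfx_fin na := (aP (iter n f (vpath v))).2 (ex_intro _ n (fpfx_refl _)).
have /pfx_fin/fpfx_len nSa :=
  (aP (iter n.+1 f (vpath v))).2 (ex_intro _ n.+1 (fpfx_refl _)).
rewrite (fpfx_eq an (fpfx_len na)) in nSa *.
by have [_ []] := fP (iter n f (vpath v)) => //; rewrite ltnNge nSa.
Qed.

End Concatenation.

(** * The topology of the graph groupoid *)

Lemma filter_bigcap (I T : Type) (K : set I) (f : I -> set T)
    (F : set_system T) : Filter F -> finite_set K ->
  (forall i, K i -> F (f i)) -> F (\bigcap_(i in K) f i).
Proof.
elim/Pchoice: I => I in K f *; move=> FF /finite_fsetP[X ->] H.
by apply: filter_bigI => i iX; exact: H.
Qed.

Section Cylinders.
Variable E : digraph.
Implicit Types (a b c d e : finpath E) (x y z : gpath E) (g h : garrow E).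

Lemma cylinderP a b g : cylinder a b g <->
  exists x, [/\ fsrc a = prng x, fsrc b = prng x, boundary x &
    [/\ ga_r g = papp a x, ga_deg g = ((flen a)%:Z - (flen b)%:Z)%R &
        ga_s g = papp b x]].
Proof.
split=> [[x [ax [bx [Xx -> -> ->]]]]|[x [ax bx Xx [r k s]]]].
  by exists x; rewrite -(pappE ax) -(pappE bx).
by exists x, ax, bx; rewrite -(pappE ax) -(pappE bx).
Qed.

Lemma cylinder_exists g : exists a b, cylinder a b g.
Proof.
by case: g => r k s [a [b [x [ax [bx [? ? ? ?]]]]]]; exists a, b, x, ax, bx.
Qed.

Lemma arrow_exists a b x : fsrc a = prng x -> fsrc b = prng x -> boundary x ->
  exists g, [/\ cylinder a b g, ga_r g = papp a x,
    ga_deg g = ((flen a)%:Z - (flen b)%:Z)%R & ga_s g = papp b x].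
Proof.
move=> ax bx Xx.
have w : in_GE (papp a x) ((flen a)%:Z - (flen b)%:Z)%R (papp b x).
  by exists a, b, x, ax, bx; rewrite -(pappE ax) -(pappE bx).
by exists (GArrow w); split=> //; apply/cylinderP; exists x.
Qed.

Lemma cylinder_src a b g : cylinder a b g -> fsrc a = fsrc b.
Proof. by move=> /cylinderP[x [-> ->]]. Qed.

Lemma cylinder_pfxr a b g : cylinder a b g -> pfx a (ga_r g).
Proof. by move=> /cylinderP[x [ax bx _ [-> _ _]]]; exact: pfx_papp. Qed.

Lemma cylinder_pfxs a b g : cylinder a b g -> pfx b (ga_s g).
Proof. by move=> /cylinderP[x [ax bx _ [_ _ ->]]]; exact: pfx_papp. Qed.

Lemma cylinder_deg a b g : cylinder a b g ->
  ga_deg g = ((flen a)%:Z - (flen b)%:Z)%R.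
Proof. by move=> /cylinderP[x [_ _ _ []]]. Qed.

Lemma boundary_r g : boundary (ga_r g).
Proof.
have [a [b /cylinderP[x [ax bx Xx [-> _ _]]]]] := cylinder_exists g.
by rewrite boundary_papp.
Qed.

Lemma boundary_s g : boundary (ga_s g).
Proof.
have [a [b /cylinderP[x [ax bx Xx [_ _ ->]]]]] := cylinder_exists g.
by rewrite boundary_papp.
Qed.

Lemma cylinder_inv a b g : cylinder a b g <-> cylinder b a (ga_inv g).
Proof.
split=> /cylinderP[x [ax bx Xx [e1 e2 e3]]]; apply/cylinderP; exists x.
  by split=> //; split=> //=; rewrite e2 opprB.
by split=> //; split=> //; rewrite -(opprB (flen b)%:Z) -e2 /= opprK.
Qed.

(** The elements of [Z(a, b)] are of the form [(a x, k, b x)] with [x] read off from the range, so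
    refining the cylinder by [d] only tests a prefix of the range. *)
Lemma cylinder_fapp a b d g : fsrc a = frng d -> fsrc b = frng d ->
  cylinder (fapp a d) (fapp b d) g <-> cylinder a b g /\ pfx (fapp a d) (ga_r g).
Proof.
move=> ad bd; split.
  move=> cg; split; last exact: cylinder_pfxr cg.
  move/cylinderP: cg => [x []]; rewrite !fsrc_fapp// => dx _ Xx [r k s].
  apply/cylinderP; exists (papp d x); split; rewrite ?prng_papp ?boundary_papp//.
  rewrite r s !pappA//; split=> //.
  by rewrite k !flen_fapp//; lia.
move=> [/cylinderP[x [ax bx Xx [r k s]]]]; rewrite r => /pfx_papp2 -/(_ ad ax).
move=> [y [dy xE]]; apply/cylinderP; exists y; rewrite !fsrc_fapp//; split=> //.
  by rewrite xE boundary_papp in Xx.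
rewrite r s xE !pappA//; split=> //.
by rewrite k !flen_fapp//; lia.
Qed.

Lemma cylinder_sub a b d : fsrc a = frng d -> fsrc b = frng d ->
  cylinder (fapp a d) (fapp b d) `<=` cylinder a b.
Proof. by move=> ad bd g /cylinder_fapp[]. Qed.

Lemma cylinder_fapp_s a b d g : fsrc a = frng d -> fsrc b = frng d ->
  cylinder (fapp a d) (fapp b d) g <-> cylinder a b g /\ pfx (fapp b d) (ga_s g).
Proof.
move=> ad bd; rewrite cylinder_inv cylinder_fapp//=.
by rewrite [cylinder a b g]cylinder_inv.
Qed.

(** The ranges give [e]. Then [g] lies in [Z(a e, b e)] too, and comparing degrees shows that [d]
    and [b e] are prefixes of the source with the same length. *)
Lemma cylinder_nested a b c d g : cylinder a b g -> cylinder c d g ->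
  flen a <= flen c ->
  exists e, [/\ fsrc a = frng e, fsrc b = frng e, c = fapp a e & d = fapp b e].
Proof.
move=> ab cd ac; have ks := cylinder_deg ab; have kt := cylinder_deg cd.
have [e [ae cE]] := pfx_comparable (cylinder_pfxr ab) (cylinder_pfxr cd) ac.
have be : fsrc b = frng e by rewrite -(cylinder_src ab).
have : cylinder (fapp a e) (fapp b e) g.
  by apply/cylinder_fapp => //; split=> //; rewrite -cE; exact: cylinder_pfxr cd.
move=> /cylinder_pfxs be'; exists e; split=> //.
have le : flen d = flen (fapp b e).
  have := flen_fapp ae; rewrite -cE flen_fapp//; lia.
apply: fpfx_eq; last by rewrite le.
by apply: pfx_comparable (cylinder_pfxs cd) be' _; rewrite le.
Qed.

Lemma cylinder_mul a b c g h : ga_s g = ga_r h -> cylinder a b g ->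
  cylinder b c h -> cylinder a c (ga_mul g h).
Proof.
move=> gh /cylinderP[x [ax bx Xx [r k s]]] /cylinderP[y [bY cy Xy [r' k' s']]].
have xy : x = y by apply: (@papp_inj E b) => //; rewrite -s gh.
subst y.
have [e1 e2 e3] := ga_mulE gh.
apply/cylinderP; exists x; split=> //; rewrite e1 e2 e3 r k k' s'.
by split=> //; lia.
Qed.

Lemma cylinder_rng a g : cylinder a a (ga_rng g) <-> pfx a (ga_r g).
Proof.
split=> [/cylinder_pfxr//|[x [ax r]]]; apply/cylinderP; exists x.
split=> //; last by split=> //=; rewrite subrr.
by have := boundary_r g; rewrite r boundary_papp.
Qed.

(** A prefix of the range longer than [a] is detected by a smaller cylinder [Z(a d, b d)], a shorter
    one by [a] itself. Sources follow by inversion. *)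
Lemma garrow_ext g h : (forall a b, cylinder a b g <-> cylinder a b h) -> g = h.
Proof.
move=> gh.
have aux (g' h' : garrow E) : (forall a b, cylinder a b g' <-> cylinder a b h') ->
    forall a, pfx a (ga_r g') -> pfx a (ga_r h').
  move=> gh' c cg; have [a [b ab]] := cylinder_exists g'.
  have ap := cylinder_pfxr ab.
  have [/(pfx_comparable cg ap)|/ltnW/(pfx_comparable ap cg)] := leqP (flen c) (flen a).
    by move=> /fpfx_pfx; apply; apply: cylinder_pfxr; exact/gh'/ab.
  move=> [d [ad cE]]; rewrite cE in cg *.
  apply: (@cylinder_pfxr _ (fapp b d)); apply/gh'/cylinder_fapp => //.
  by rewrite -(cylinder_src ab).
have inv : forall a b, cylinder a b (ga_inv g) <-> cylinder a b (ga_inv h).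
  by move=> a b; rewrite -!cylinder_inv.
apply: garrow_eq.
- by apply: pfx_ext => a; split; apply: aux => // b c; rewrite gh.
- have [a [b ab]] := cylinder_exists g.
  by rewrite (cylinder_deg ab) (cylinder_deg ((gh _ _).1 ab)).
- apply: pfx_ext => a; split; apply: (aux (ga_inv _) (ga_inv _)) => // b c.
  by rewrite inv.
Qed.

(* Hence, inside [Z(a, b)], membership in another cylinder can be read off from
   the range. *)
Lemma cylinder_trichotomy a b c d : 
  [\/ cylinder a b `<=` cylinder c d,
      exists e, [/\ fsrc a = frng e, fsrc b = frng e, c = fapp a e & d = fapp b e] |
      cylinder a b `&` cylinder c d = set0].
Proof.
have [[g [ab cd]]|h] := pselect (cylinder a b `&` cylinder c d !=set0); last first.
  by apply: Or33; rewrite -subset0 => g gg; apply: h; exists g.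
have [ac|ca] := leqP (flen a) (flen c).
  by apply: Or32; exact: cylinder_nested ab cd ac.
have [e [ce de -> ->]] := cylinder_nested cd ab (ltnW ca).
by apply: Or31; exact: cylinder_sub.
Qed.

Lemma cylinderD0 a b : cylinderD a b set0 = cylinder a b.
Proof.
rewrite /cylinderD (_ : [set g | _] = set0) ?setD0//.
by rewrite -subset0 => g [? [? [? []]]].
Qed.

(** * Cylinders are compact and clopen; convergence of arrows *)

Lemma open_cylinderD a b (K : set (finpath E)) : fsrc a = fsrc b ->
  finite_set K -> (forall c, K c -> frng c = fsrc a) -> open (cylinderD a b K).
Proof.
move=> ab fK Ka; have oab : basic_open (cylinderD a b K) by exists a, b, K.
pose D : set_system (garrow E) := finI_from (@basic_open E) id.
exists [set cylinderD a b K]; last by rewrite bigcup_set1.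
by move=> _ ->; exact: (@finI_from1 _ _ (@basic_open E) id).
Qed.

Lemma open_cylinder a b : open (cylinder a b).
Proof.
have [ab|ab] := pselect (fsrc a = fsrc b).
  by rewrite -cylinderD0; apply: open_cylinderD => //; exact: finite_set0.
rewrite (_ : cylinder a b = set0); first exact: open0.
by rewrite -subset0 => g /cylinder_src.
Qed.

Lemma open_cylinderC a b : open (~` cylinder a b).
Proof.
rewrite openE => g nab; have [c [d cd]] := cylinder_exists g.
rewrite /interior nbhsE /=.
have [sub|[e [ce de aE bE]]|dis] := cylinder_trichotomy c d a b.
- by have := nab (sub _ cd).
(* This is where deleted sets matter: [Z(a, b)] sits inside [Z(c, d)] without containing [g], and is
   cut out of this neighbourhood. *)
- exists (cylinderD c d [set e]); last first.
    move=> h [hcd nh] hab; apply: nh; exists e, ce, de; split=> //.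
    by rewrite -!fappE -aE -bE.
  split; first by apply: open_cylinderD; [exact: cylinder_src cd|
    exact: finite_set1|move=> _ ->].
  split=> // -[e' [ce' [de' [ee]]]]; rewrite -!fappE {ce' de'}ee.
  by rewrite -aE -bE.
- exists (cylinder c d); first by split=> //; exact: open_cylinder.
  by move=> h hcd hab; suff : set0 h by []; rewrite -dis.
Qed.

Lemma garrow_cvgP (F : set_system (garrow E)) g : Filter F ->
  (F --> g) <-> forall a b, (cylinder a b g -> F (cylinder a b)) /\
    (~ cylinder a b g -> F (~` cylinder a b)).
Proof.
move=> FF; split=> [Fg a b|H].
  by split=> gab; apply: Fg; apply: open_nbhs_nbhs; split=> //;
    [exact: open_cylinder|exact: open_cylinderC].
move=> A; rewrite nbhsE => -[B [[D sD <-]] [I DI Ig] sA].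
apply: filterS sA _; apply: (@filterS _ _ _ I).
  by move=> h Ih; exists I.
have [K sK IE] := sD I DI; rewrite -IE; apply: filter_bigI => U UK.
have := sK U UK; rewrite inE => -[a [b [L [ab fL Lr UE]]]].
have [gab nK] : cylinderD a b L g.
  by rewrite -UE; rewrite -IE in Ig; exact: (Ig U UK).
rewrite UE; apply: filterI; first exact: (H a b).1.
apply: filterS (_ : F (\bigcap_(c in L) ~` cylinder (fapp a c) (fapp b c))).
  move=> h hL [c [ac [bc [Lc]]]]; rewrite -!fappE; exact: hL.
apply: filter_bigcap => // c Lc; apply: (H _ _).2 => gc; apply: nK.
have ac : fsrc a = frng c by rewrite Lr.
have bc : fsrc b = frng c by rewrite -ab.
by exists c, ac, bc; rewrite -!fappE.
Qed.

Lemma garrow_hausdorff : hausdorff_space (garrow E).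
Proof.
move=> g h gh; apply: garrow_ext => a b; split=> ab; apply: contrapT => nab.
- have [||k []//] := gh (cylinder a b) (~` cylinder a b);
    apply: open_nbhs_nbhs; split=> //.
    exact: open_cylinder.
  exact: open_cylinderC.
- have [||k []//] := gh (~` cylinder a b) (cylinder a b);
    apply: open_nbhs_nbhs; split=> //.
    exact: open_cylinderC.
  exact: open_cylinder.
Qed.

Lemma ultra_bigcup (I T : Type) (K : set I) (f : I -> set T)
    (F : set_system T) : UltraFilter F -> finite_set K ->
  F (\bigcup_(i in K) f i) -> exists2 i, K i & F (f i).
Proof.
move=> UF fK FK; apply: contrapT => H.
have FC : F (\bigcap_(i in K) ~` f i).
  apply: filter_bigcap => // i Ki.
  by have [Ff|//] := in_ultra_setVsetC (f i) UF; case: H; exists i.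
have [x [[i Ki fx] /(_ i Ki)]] := filter_ex (filterI FK FC).
exact.
Qed.

(** For an ultrafilter containing [Z(a, b)], the [d] such that it contains [Z(a d, b d)] form a
    chain with limit [z], and the arrow [(a z, k, b z)] is the limit. If [z] were finite and not a
    boundary path, its source would receive finitely many edges, at least one; the ultrafilter would
    then select one of them and produce a prefix longer than [z]. *)
Lemma compact_cylinder a b : compact (cylinder a b).
Proof.
rewrite compact_ultra => F UF Fab.
have [g0 /cylinder_src ab] := filter_ex Fab.
pose P := [set d | fsrc a = frng d /\ F (cylinder (fapp a d) (fapp b d))].
have [|d e [d' [dd' eE]] [ae Fe]|d e [ad Fd] [ae Fe] de|z zP] := @chain_gpath E P.
- exists (vpath (fsrc a)); split=> //.
  by rewrite fapp_vpath [X in vpath X]ab fapp_vpath.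
- rewrite eE frng_fapp in ae; split=> //; apply: filterS Fe.
  rewrite eE -!fappA -?ab//.
  by apply: cylinder_sub; rewrite fsrc_fapp -?ab.
- have bd : fsrc b = frng d by rewrite -ab.
  have be : fsrc b = frng e by rewrite -ab.
  have [g [gd ge]] := filter_ex (filterI Fd Fe).
  have [|c []] := cylinder_nested gd ge; first by rewrite !flen_fapp// leq_add2l.
  rewrite fsrc_fapp// => dc _ + _; rewrite fappA// => /fapp_inj -> //.
    exact: fpfx_fapp.
  by rewrite frng_fapp.
have Pv : P (vpath (fsrc a)).
  by split=> //; rewrite fapp_vpath [X in vpath X]ab fapp_vpath.
have az : fsrc a = prng z by apply/pfx_vpath/zP.
have bz : fsrc b = prng z by rewrite -ab.
have Xz : boundary z.
  case: z zP az bz => // d dP /= ad bd; apply: contrapT => /not_orP[ns nir].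
  have [_ Fd] : P d by apply/dP/pfx_fin/fpfx_refl.
  have sub : cylinder (fapp a d) (fapp b d) `<=` \bigcup_(e in receives (fsrc d))
      cylinder (fapp a (fapp d (epath e))) (fapp b (fapp d (epath e))).
    move=> g gd; have [gE|[e []]] := pfx_step (cylinder_pfxr gd).
      by have := boundary_r g; rewrite gE /= fsrc_fapp// => -[].
    rewrite fsrc_fapp// => de ge; exists e; first exact/esym.
    rewrite -!fappA//; apply/cylinder_fapp; rewrite ?fsrc_fapp//.
  have [|e re Fe] := ultra_bigcup UF _ (filterS sub Fd); first exact: contrapT.
  have : P (fapp d (epath e)) by split=> //; rewrite frng_fapp.
  by move=> /dP/pfx_fin/fpfx_len; rewrite flen_fapp// addn1 ltnn.
have [g [gab gr gk gs]] := arrow_exists az bz Xz.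
exists g; split=> //; apply/garrow_cvgP => c d.
have Fcd e : c = fapp a e -> d = fapp b e -> fsrc a = frng e -> 
    cylinder c d g <-> F (cylinder c d).
  move=> -> -> ae; have be : fsrc b = frng e by rewrite -ab.
  split=> [/cylinder_pfxr|Fe]; first by rewrite gr => /pfx_papp2-/(_ ae az)/zP[].
  by apply/cylinder_fapp => //; split=> //; rewrite gr; apply/pfx_papp2 => //; exact/zP.
have [sub|[e [ae be cE dE]]|dis] := cylinder_trichotomy a b c d.
- by split=> [_|[]]; [exact: filterS sub Fab|exact: sub].
- split=> [/(Fcd e)|ncd]; first exact.
  have [Fc|//] := in_ultra_setVsetC (cylinder c d) UF.
  by case: ncd; apply/(Fcd e).
- split=> [gcd|_]; first by suff : set0 g by []; rewrite -dis.
  by apply: filterS Fab => h hab hcd; suff : set0 h by []; rewrite -dis.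
Qed.

Lemma garrow_lch : lch_space (garrow E).
Proof.
split; first exact: garrow_hausdorff.
move=> g _; have [a [b ab]] := cylinder_exists g.
exists (cylinder a b).
  by rewrite withinET; apply: open_nbhs_nbhs; split=> //; exact: open_cylinder.
split; first exact: compact_cylinder.
exact: compact_closed garrow_hausdorff (@compact_cylinder a b).
Qed.

Lemma near_cylinder g a b : cylinder a b g -> nbhs g (cylinder a b).
Proof. by move=> gab; apply: open_nbhs_nbhs; split=> //; exact: open_cylinder. Qed.

Lemma near_cylinderC g a b : ~ cylinder a b g -> nbhs g (~` cylinder a b).
Proof. by move=> gab; apply: open_nbhs_nbhs; split=> //; exact: open_cylinderC. Qed.

(** On a cylinder around [g], a prefix condition on the range is either constant or membership in a
    smaller cylinder. *)
Lemma near_pfx g c :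
  (pfx c (ga_r g) -> nbhs g [set h | pfx c (ga_r h)]) /\
  (~ pfx c (ga_r g) -> nbhs g [set h | ~ pfx c (ga_r h)]).
Proof.
have [a [b gab]] := cylinder_exists g.
have ab := cylinder_src gab; have ag := cylinder_pfxr gab.
have Fab := near_cylinder gab; split=> cg.
  have [ca|/ltnW ac] := leqP (flen c) (flen a).
    have {}ca := pfx_comparable cg ag ca.
    by apply: filterS Fab => h /cylinder_pfxr; exact: fpfx_pfx.
  have [e [ae cE]] := pfx_comparable ag cg ac.
  have : cylinder (fapp a e) (fapp b e) g.
    by apply/cylinder_fapp; rewrite -?ab// -cE.
  by move=> /near_cylinder; apply: filterS => h /cylinder_pfxr; rewrite cE.
have [[e [ae cE]]|nc] := pselect (fpfx a c).
  have nce : ~ cylinder (fapp a e) (fapp b e) g.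
    by move=> /cylinder_pfxr; rewrite -cE.
  apply: filterS (filterI Fab (near_cylinderC nce)) => h [hab nh] ch; apply: nh.
  by apply/cylinder_fapp; rewrite -?ab// -cE.
apply: filterS Fab => h /cylinder_pfxr ah ch.
have [ca|/ltnW ac] := leqP (flen c) (flen a).
  by apply: cg; exact: fpfx_pfx (pfx_comparable ch ah ca) ag.
exact/nc/(pfx_comparable ah ch).
Qed.

(** Inside one cylinder an arrow is determined by its range, so convergence there is tested on
    prefixes of the range alone. *)
Lemma cvg_in_cylinder (F : set_system (garrow E)) g a b : Filter F ->
  cylinder a b g -> F (cylinder a b) ->
  (forall c, (pfx c (ga_r g) -> F [set h | pfx c (ga_r h)]) /\
    (~ pfx c (ga_r g) -> F [set h | ~ pfx c (ga_r h)])) ->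
  F --> g.
Proof.
move=> FF gab Fab H; apply/garrow_cvgP => c d.
have [sub|[e [ae be -> ->]]|dis] := cylinder_trichotomy a b c d.
- by split=> [_|[]]; [exact: filterS sub Fab|exact: sub].
- split=> [/cylinder_fapp[]// _ /(H _).1 Fc|nc].
    apply: filterS (filterI Fab Fc) => h [hab hc].
    exact/cylinder_fapp.
  have {}nc : ~ pfx (fapp a e) (ga_r g) by move=> ?; apply/nc/cylinder_fapp.
  by apply: filterS ((H _).2 nc) => h nh /cylinder_pfxr.
- split=> [gcd|_]; first by suff : set0 g by []; rewrite -dis.
  by apply: filterS Fab => h hab hcd; suff : set0 h by []; rewrite -dis.
Qed.

(** * Continuity of the groupoid operations *)

Lemma ga_rng_continuous : continuous (@ga_rng E).
Proof.
move=> g; have [a [b gab]] := cylinder_exists g.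
apply: (@cvg_in_cylinder _ _ a a).
- by apply: fmap_filter; exact: nbhs_filter.
- exact/cylinder_rng/(cylinder_pfxr gab).
- apply: filterS (near_cylinder gab) => h hab.
  exact/cylinder_rng/(cylinder_pfxr hab).
- by move=> c; have [H1 H2] := near_pfx g c; split=> [/H1|/H2]; exact: filterS.
Qed.

Lemma ga_inv_continuous : continuous (@ga_inv E).
Proof.
move=> g; have FF : Filter (ga_inv x @[x --> g]).
  by apply: fmap_filter; exact: nbhs_filter.
apply/garrow_cvgP => a b; split=> H.
  by apply: filterS (near_cylinder ((cylinder_inv _ _ _).2 H)) => h /cylinder_inv.
have : ~ cylinder b a g by move=> /cylinder_inv/H.
by move=> /near_cylinderC; apply: filterS => h hba hab; apply/hba/cylinder_inv.
Qed.

(** The two prefixes of the common middle path are comparable; the cylinder with the shorter one is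
    refined to match the other. *)
Lemma composable_cylinders g h : ga_s g = ga_r h ->
  exists a b c, cylinder a b g /\ cylinder b c h.
Proof.
move=> gh; have [a [b gab]] := cylinder_exists g; have [c [d hcd]] := cylinder_exists h.
have bg := cylinder_pfxs gab; have := cylinder_pfxr hcd; rewrite -gh => cg.
have [bc|/ltnW cb] := leqP (flen b) (flen c).
  have [e [be cE]] := pfx_comparable bg cg bc.
  exists (fapp a e), c, d; split=> //; rewrite cE; apply/cylinder_fapp_s => //.
    by rewrite (cylinder_src gab).
  by split=> //; rewrite -cE.
have [e [ce bE]] := pfx_comparable cg bg cb.
exists a, b, (fapp d e); split=> //; rewrite bE; apply/cylinder_fapp => //.
  by rewrite -(cylinder_src hcd).
by split=> //; rewrite -bE -gh.
Qed.

Lemma ga_mul_continuous :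
  {within @composable (graph_groupoid E),
    continuous (fun p : garrow E * garrow E => ga_mul p.1 p.2)}.
Proof.
apply/subspace_continuousP => -[g h] /ga_compos /= gh.
have [a [b [c [gab hbc]]]] := composable_cylinders gh.
have near1 (A : set (garrow E)) : nbhs g A ->
    within (@composable (graph_groupoid E)) (nbhs (g, h)) [set p | A p.1].
  move=> gA; have : nbhs (g, h) [set p | A p.1].
      exact: (@cvg_fst _ _ (nbhs g) (nbhs h)).
    by apply: filterS.
have near2 (A : set (garrow E)) : nbhs h A ->
    within (@composable (graph_groupoid E)) (nbhs (g, h)) [set p | A p.2].
  move=> gA; have : nbhs (g, h) [set p | A p.2].
      exact: (@cvg_snd _ _ (nbhs g) (nbhs h)).
    by apply: filterS.
have near3 : within (@composable (graph_groupoid E)) (nbhs (g, h))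
    (@composable (graph_groupoid E)) by exact: withinT.
have [r _ _] := ga_mulE gh.
rewrite /from_subspace /=; apply: (@cvg_in_cylinder _ _ a c).
- exact: cylinder_mul gab hbc.
- apply: filterS (filterI near3 (filterI (near1 _ (near_cylinder gab))
    (near2 _ (near_cylinder hbc)))).
  by move=> [g' h'] [/ga_compos gh' /= [k1 k2]]; exact: cylinder_mul gh' k1 k2.
- move=> d; have [H1 H2] := near_pfx g d; rewrite r.
  split=> [/H1|/H2] /near1 H; apply: filterS (filterI near3 H);
    by move=> [g' h'] [/ga_compos /ga_mulE[rr _ _]]; rewrite /= rr.
Qed.

(** The range map has local sections: replacing [(a x, 0, a x)] by [(a x, k, b x)] leads from
    [Z(a, a)] back to [Z(a, b)]. Continuity of this section at the range of [g] gives a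
    neighbourhood of that unit inside the image. *)
Lemma ga_rng_open : open_map (@ga_rng E).
Proof.
move=> U oU; rewrite openE => _ [g Ug <-]; rewrite /interior.
have [a [b gab]] := cylinder_exists g; have ab := cylinder_src gab.
(* Off [Z(a, a)] the section takes the junk value [u]. *)
have ex u : exists h, cylinder a a u -> cylinder a b h /\ ga_rng h = u.
  have [/cylinderP[x [ax _ Xx [r k s]]]|] := pselect (cylinder a a u); last by exists u.
  have bx : fsrc b = prng x by rewrite -ab.
  have [h [hab hr hk hs]] := arrow_exists ax bx Xx.
  exists h => _; split=> //; apply: garrow_eq => /=.
  - by rewrite hr r.
  - by rewrite k subrr.
  - by rewrite hr s.
have [f fP] := choice ex.
have uaa : nbhs (ga_rng g) (cylinder a a).
  exact/near_cylinder/cylinder_rng/(cylinder_pfxr gab).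
have fg : f u @[u --> ga_rng g] --> g.
  apply: (@cvg_in_cylinder _ _ a b) => //.
    by apply: fmap_filter; exact: nbhs_filter.
    by apply: filterS uaa => u /fP[].
  move=> c; have [H1 H2] := near_pfx (ga_rng g) c.
  split=> [/H1|/H2] H; apply: filterS (filterI uaa H) => u [/fP[_ {1}<-]];
    exact.
have Uf : nbhs (ga_rng g) (f @^-1` U) by apply: fg; exact: open_nbhs_nbhs.
by apply: filterS (filterI uaa Uf) => u [/fP[_ fu] Ufu]; exists (f u).
Qed.

Lemma graph_lch_groupoid : lch_groupoid (graph_groupoid E).
Proof.
split; first exact: garrow_lch.
  exact: ga_mul_continuous.
exact: ga_inv_continuous.
Qed.

(** The range vertex is locally constant. As [S] is arbitrary, the complement is open as well, so
    the set is clopen. *)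
Lemma open_prng (S : set (vert E)) : open [set g : garrow E | S (prng (ga_r g))].
Proof.
rewrite openE => g Sg; have [a [b gab]] := cylinder_exists g.
apply: filterS (near_cylinder gab) => h /cylinder_pfxr/pfx_rng ah.
by move: Sg => /=; rewrite -(pfx_rng (cylinder_pfxr gab)) ah.
Qed.

End Cylinders.

(** * Reduction to a full clopen set of units *)

Lemma fmap_ultra (S T : Type) (f : S -> T) (F : set_system S) :
  UltraFilter F -> UltraFilter (f @ F).
Proof.
move=> UF; split=> [|H HF sH]; first exact: fmap_proper_filter.
apply/funext => A; apply/propext; split=> [HA|]; last exact: sH.
have [//|FA] := in_ultra_setVsetC (f @^-1` A) UF.
have HAc : H (~` A) by exact: sH.
by have [x []] := filter_ex (filterI HA HAc).
Qed.

(** * Subspaces, homeomorphisms and quotients *)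

Section SetType.
Variables (X : topologicalType) (A : set X).

Lemma set_type_cvg (T : Type) (F : set_system T) (f : T -> set_type A)
    (x : set_type A) : Filter F ->
  (f @ F --> x) <-> ((fun t => \val (f t)) @ F --> \val x).
Proof.
move=> FF; split=> [fx U Ux|fx U].
  apply: (fx (\val @^-1` U)); move: Ux; rewrite !nbhsE => -[V [oV Vx] VU].
  exists (\val @^-1` V); last by move=> y; exact: VU.
  by split=> //; exists V.
rewrite nbhsE => -[_ [[V oV <-] Vx] VU].
apply: filterS VU _; apply: (fx V); exact: open_nbhs_nbhs.
Qed.

Lemma set_val_continuous : continuous (\val : set_type A -> X).
Proof. by move=> x; apply: (@set_type_cvg _ (nbhs x) id x _).1; exact: cvg_id. Qed.

Lemma set_type_continuous (Y : topologicalType) (f : Y -> set_type A) :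
  continuous (fun y => \val (f y)) -> continuous f.
Proof. by move=> cf y; apply: (@set_type_cvg _ (nbhs y) f _ _).2; exact: cf. Qed.

Lemma set_type_open (V : set X) : open V -> open [set y : set_type A | V (\val y)].
Proof. by exists V. Qed.

Lemma set_type_openP (U : set (set_type A)) :
  open U -> exists2 V : set X, open V & U = [set y | V (\val y)].
Proof. by move=> [V oV <-]; exists V. Qed.

Lemma set_type_hausdorff : hausdorff_space X -> hausdorff_space (set_type A).
Proof.
move=> hX x y xy; apply: val_inj; apply: hX => U V Ux Vy.
have [||z []] := xy (\val @^-1` U) (\val @^-1` V).
- exact: (set_val_continuous Ux).
- exact: (set_val_continuous Vy).
by exists (\val z).
Qed.

Lemma set_type_compact (K : set X) : closed A -> compact K ->
  compact [set y : set_type A | K (\val y)].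
Proof.
rewrite !compact_ultra => cA cK F UF FK.
have UF' := fmap_ultra \val UF.
have [|p [Kp Fp]] := cK (\val @ F); first exact: FK.
have Ap : A p.
  apply: (closed_cvg A cA _ p Fp).
  by apply: nearW => y; exact: set_valP.
exists (exist _ p (mem_set Ap)); split=> //.
exact: (@set_type_cvg _ F id (exist _ p (mem_set Ap)) _).2.
Qed.

Lemma set_type_lch : closed A -> lch_space X -> lch_space (set_type A).
Proof.
move=> cA [hX lX]; have hA := set_type_hausdorff hX; split=> // x _.
have [K xK [cK clK]] := lX (\val x) I; rewrite withinET in xK.
have cK' := set_type_compact cA cK.
exists [set y : set_type A | K (\val y)].
  by rewrite withinET; exact: set_val_continuous xK.
by split=> //; exact: compact_closed hA cK'.
Qed.

End SetType.

(** For a compact neighbourhood [C] and an open [V], the image of [C] minus [V] is compact, hence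
    closed. Removing it from the open image of [C] leaves a neighbourhood of [y] that the inverse
    maps into [V]. *)
Lemma locally_compact_homeomorphism (X Y : topologicalType) (f : X -> Y)
    (k : Y -> X) : hausdorff_space Y -> continuous f -> cancel f k ->
  cancel k f ->
  (forall x : X, exists C : set X, [/\ nbhs x C, compact C & open (f @` C)]) ->
  homeomorphism f.
Proof.
move=> hY cf fk kf H; split=> //; exists k; split=> // y.
have [C [xC cC oC]] := H (k y); move=> U; rewrite nbhsE => -[V [oV Vx] VU].
have cD : closed (f @` (C `&` ~` V)).
  apply: compact_closed hY _; apply: continuous_compact.
    exact: continuous_subspaceT.
  by apply: compact_closedI => //; exact: open_closedC.
have oW : open (f @` C `&` ~` (f @` (C `&` ~` V))).
  by apply: openI => //; exact: closed_openC.
have : nbhs y (f @` C `&` ~` (f @` (C `&` ~` V))).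
  apply: open_nbhs_nbhs; split=> //; split.
    by exists (k y) => //; exact: nbhs_singleton.
  by move=> [x [_ nVx] xy]; apply: nVx; rewrite -(fk x) xy.
apply: filterS => _ [[x Cx <-] nx]; apply: VU; rewrite fk.
by apply: contrapT => nVx; apply: nx; exists x.
Qed.

Section Quotient.
Local Open Scope quotient_scope.

(** A continuous open surjection is a quotient map. Both orbit spaces of the equivalence are
    identified with unit spaces in this way. *)
Lemma quotient_homeomorphism (Z U : topologicalType) (e : equiv_rel Z)
    (r : Z -> U) : continuous r -> open_map r -> (forall u, exists z, r z = u) ->
  (forall x y, e x y <-> r x = r y) ->
  exists f : quotient_topology {eq_quot e} -> U,
    homeomorphism f /\ forall z, f (\pi_{eq_quot e} z) = r z.
Proof.
move=> cr or sr er.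
have rpi z : r (repr (\pi_{eq_quot e} z)) = r z.
  by apply/er; rewrite -eqmodE reprK.
have [g gP] := choice sr.
exists (r \o repr); split; last exact: rpi.
split.
  apply: (@repr_comp_continuous Z {eq_quot e} U r cr).
  by move=> x y /eqP xy; apply/eqP/er; rewrite -eqmodE; apply/eqP; exact: xy.
exists (fun u => \pi_{eq_quot e} (g u)); split.
- apply/continuousP => V oV.
  rewrite (_ : _ @^-1` V = r @` (\pi_{eq_quot e} @^-1` V)); first exact: or.
  apply/seteqP; split=> [u Vu|_ [z Vz <-]] /=; first by exists (g u).
  rewrite (_ : \pi_{eq_quot e} _ = \pi_{eq_quot e} z)//.
  by apply/eqP; rewrite eqmodE; apply/er; rewrite gP.
- move=> q /=; rewrite -[RHS]reprK; apply/eqP; rewrite eqmodE; apply/er.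
  by rewrite gP.
- by move=> u /=; rewrite rpi gP.
Qed.

End Quotient.

Section GroupoidTheory.
Variable G : groupoid.

Lemma gmulK (g h : G) : gs g = gr h -> gmul (gmul g h) (ginv h) = g.
Proof.
by move=> gh; rewrite -gmulA ?gr_inv// gmulV -gh gmul_s.
Qed.

Lemma gmulVK (g h : G) : gs g = gr h -> gmul (ginv g) (gmul g h) = h.
Proof. by move=> gh; rewrite gmulA ?gs_inv// gmulVg gh gmul_r. Qed.

Lemma ginvK (g : G) : ginv (ginv g) = g.
Proof.
rewrite -[LHS]gmul_s gs_inv gr_inv -gmulVg gmulA; last 2 first.
- by rewrite gs_inv.
- by rewrite gs_inv.
by rewrite gmulVg gs_inv gmul_r.
Qed.

(** Multiplication is continuous only on composable pairs, so [F] has to concentrate on them. *)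
Lemma gmul_cvg (T : Type) (F : set_system T) (u v : T -> G) (g h : G) :
  Filter F ->
  {within @composable G, continuous (fun p : G * G => gmul p.1 p.2)} ->
  u @ F --> g -> v @ F --> h -> gs g = gr h ->
  F [set t | gs (u t) = gr (v t)] ->
  (fun t => gmul (u t) (v t)) @ F --> gmul g h.
Proof.
move=> FF /subspace_continuousP cm ug vh gh Fc.
have := cm (g, h) gh; apply: cvg_trans => U /= FU.
have H : F [set t | gs (u t) = gr (v t) -> U (gmul (u t) (v t))] :=
  @cvg_pair _ _ _ F (nbhs g) (nbhs h) FF (nbhs_filter g) (nbhs_filter h) u v ug vh _ FU.
suff : F [set t | U (gmul (u t) (v t))] by [].
by apply: filterS (filterI Fc H) => t [gst]; exact.
Qed.

End GroupoidTheory.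

(** * The equivalence carried by the arrows with range in a clopen set of units *)

Section FullReduction.
Variables (G : groupoid) (W A : set G).
Hypothesis lG : lch_groupoid G.
Hypothesis gr_cont : continuous (@gr G).
Hypothesis gr_op : open_map (@gr G).
Hypothesis oW : open W.
Hypothesis cW : closed W.
(** A set of units is encoded by its preimage [W] under the range map, so that [W] is at the same
    time the space carrying the two actions. *)
Hypothesis Wr : forall g : G, W (gr g) <-> W g.
Hypothesis AE : forall g : G, A g <-> W (gr g) /\ W (gs g).
Hypothesis full : forall u : G, gr u = u -> exists2 g, W g & gs g = u.
Hypothesis clA : subgroupoid_closed A.

Local Notation GA := (subgroupoid clA).
Local Notation Z := (set_type W).

Let hG : hausdorff_space G. Proof. by case: lG => -[]. Qed.

Let mul_cont :
  {within @composable G, continuous (fun p : G * G => gmul p.1 p.2)}.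
Proof. by case: lG. Qed.

Let inv_cont : continuous (@ginv G). Proof. by case: lG. Qed.

Lemma gs_continuous : continuous (@gs G).
Proof.
have -> : @gs G = @gr G \o @ginv G by apply/funext => g /=; rewrite gr_inv.
by move=> g; apply: continuous_comp; [exact: inv_cont|exact: gr_cont].
Qed.

Lemma gs_open : open_map (@gs G).
Proof.
move=> U oU; rewrite (_ : @gs G @` U = @gr G @` (@ginv G @^-1` U)).
  by apply: gr_op; move/continuousP: inv_cont; apply.
apply/seteqP; split=> _ [g Ug <-]; exists (ginv g) => //=.
- by rewrite ginvK.
- by rewrite gr_inv.
- by rewrite gs_inv.
Qed.

Lemma reduction_arr (g : G) : A g -> W g.
Proof. by move=> /AE[/Wr]. Qed.

Lemma reduction_unit (g : G) : W g -> A (gr g).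
Proof. by move=> Wg; apply/AE; rewrite gr_r gs_r; split; apply/Wr. Qed.

Definition red_r0 (z : Z) : GA :=
  exist _ (gr (\val z)) (mem_set (reduction_unit (set_valP z))).

Lemma red_r_subproof (z : Z) : @unit_set GA (red_r0 z).
Proof. by apply: val_inj; rewrite /= gr_r. Qed.

Definition red_r (z : Z) : unit_space GA :=
  exist _ (red_r0 z) (mem_set (red_r_subproof z)).

Definition red_s (z : Z) : unit_space G :=
  exist _ (gs (\val z)) (mem_set (gr_s (\val z) : unit_set (gs (\val z)))).

Lemma red_lact_subproof (g : GA) (z : Z) : gs (\val g) = gr (\val z) ->
  W (gmul (\val g) (\val z)).
Proof.
move=> gz; apply/Wr; rewrite gr_mul//; apply/Wr/reduction_arr.
exact: (set_valP g).
Qed.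

Definition red_lact (g : GA) (z : Z) : Z :=
  if pselect (gs (\val g) = gr (\val z)) is left h
  then SigSub (mem_set (red_lact_subproof h)) else z.

Lemma red_lactE g z : gs (\val g) = gr (\val z) ->
  \val (red_lact g z) = gmul (\val g) (\val z).
Proof. by rewrite /red_lact; case: pselect. Qed.

Lemma red_ract_subproof (z : Z) (g : G) : gs (\val z) = gr g ->
  W (gmul (\val z) g).
Proof. by move=> gz; apply/Wr; rewrite gr_mul//; apply/Wr/(set_valP z). Qed.

Definition red_ract (z : Z) (g : G) : Z :=
  if pselect (gs (\val z) = gr g) is left h
  then SigSub (mem_set (red_ract_subproof h)) else z.

Lemma red_ractE z g : gs (\val z) = gr g ->
  \val (red_ract z g) = gmul (\val z) g.
Proof. by rewrite /red_ract; case: pselect. Qed.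

Program Definition red_left : left_action GA Z :=
  @LeftAction GA Z red_r red_lact _ _ _.
Next Obligation.
move=> u.
have uu : gr (\val (\val u)) = \val (\val u).
  by have := set_valP u => /(congr1 \val).
exists (exist _ (\val (\val u)) (mem_set (reduction_arr (set_valP (\val u))))).
by do 2!apply: val_inj.
Qed.
Next Obligation.
move=> g h y /(congr1 \val)/= hy /(congr1 \val)/= gh.
have ghy : gs (gmul (\val g) (\val h)) = gr (\val y) by rewrite gs_mul.
split; apply: val_inj => /=.
- by rewrite val_sub_mul.
- by rewrite red_lactE// gr_mul.
- rewrite !red_lactE ?val_sub_mul//; first by rewrite gmulA.
  by rewrite gr_mul.
Qed.
Next Obligation.
by move=> y; apply: val_inj; rewrite red_lactE /= ?gs_r// gmul_r.
Qed.

Program Definition red_right : right_action G Z :=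
  @RightAction G Z red_s red_ract _ _ _.
Next Obligation.
move=> u; have [g Wg gu] := full (set_valP u).
by exists (exist _ g (mem_set Wg)); apply: val_inj.
Qed.
Next Obligation.
move=> y g h /= yg gh.
split; rewrite ?gr_mul ?red_ractE ?gs_mul//.
apply: val_inj; rewrite !red_ractE ?gs_mul ?gr_mul//.
by rewrite gmulA.
Qed.
Next Obligation.
by move=> y; apply: val_inj; rewrite red_ractE /= ?gr_s// gmul_s.
Qed.

Let val_cvg (T : Type) (X : topologicalType) (B : set X) (F : set_system T)
    (f : T -> set_type B) (x : set_type B) : Filter F ->
  f @ F --> x -> (fun t => \val (f t)) @ F --> \val x.
Proof. by move=> FF /set_type_cvg. Qed.

Lemma red_left_continuous : la_continuous red_left.
Proof.
split.
- move=> U /set_type_openP[V oV ->].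
  have -> : la_r red_left @` [set y | V (\val y)] =
      [set u | [set v : GA | (@gr G @` (V `&` W)) (\val v)] (\val u)].
    apply/seteqP; split=> [_ [z Vz <-]|u [g [Vg Wg] gu]] /=.
      by exists (\val z) => //; split=> //; exact: set_valP.
    by exists (exist _ g (mem_set Wg)) => //; do 2!apply: val_inj.
  do 2!apply: set_type_open.
  by apply: gr_op; exact: openI.
- do 2!apply: set_type_continuous.
  by move=> z; apply: continuous_comp; [exact: set_val_continuous|exact: gr_cont].
- apply/subspace_continuousP => -[g z] /(congr1 \val)/= gz.
  apply/set_type_cvg; rewrite /from_subspace /= red_lactE//.
  have near_comp : within (la_dom red_left) (nbhs (g, z))
      [set p | gs (\val p.1) = gr (\val p.2)].
    apply: filterS (withinT _ _) => -[g' z'].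
    by move=> /(congr1 \val).
  pose F := within (la_dom red_left) (nbhs (g, z)).
  have : (fun p : GA * Z => gmul (\val p.1) (\val p.2)) @ F -->
      gmul (\val g) (\val z).
    apply: gmul_cvg => //.
    + apply: val_cvg; apply: (@cvg_trans _ (fst @ nbhs (g, z))).
        exact: cvg_fmap2 (cvg_within _).
      exact: cvg_fst.
    + apply: val_cvg; apply: (@cvg_trans _ (snd @ nbhs (g, z))).
        exact: cvg_fmap2 (cvg_within _).
      exact: cvg_snd.
  apply: cvg_trans; apply: near_eq_cvg.
  by apply: filterS near_comp => p pc; rewrite red_lactE.
Qed.

Let cvg_fst_within (X Y : topologicalType) (D : set (X * Y)) (p : X * Y) :
  fst @ within D (nbhs p) --> p.1.
Proof.
apply: (@cvg_trans _ (fst @ nbhs p)); first exact: cvg_fmap2 (cvg_within _).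
exact: cvg_fst.
Qed.

Let cvg_snd_within (X Y : topologicalType) (D : set (X * Y)) (p : X * Y) :
  snd @ within D (nbhs p) --> p.2.
Proof.
apply: (@cvg_trans _ (snd @ nbhs p)); first exact: cvg_fmap2 (cvg_within _).
exact: cvg_snd.
Qed.

Lemma red_right_continuous : ra_continuous red_right.
Proof.
split.
- move=> U /set_type_openP[V oV ->].
  have -> : ra_s red_right @` [set y | V (\val y)] =
      [set u | (@gs G @` (V `&` W)) (\val u)].
    apply/seteqP; split=> [_ [z Vz <-]|u [g [Vg Wg] gu]] /=.
      by exists (\val z) => //; split=> //; exact: set_valP.
    by exists (exist _ g (mem_set Wg)) => //; apply: val_inj.
  apply: set_type_open.
  by apply: gs_open; exact: openI.
- apply: set_type_continuous.
  by move=> z; apply: continuous_comp; [exact: set_val_continuous|exact: gs_continuous].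
- apply/subspace_continuousP => -[z g] /= gz.
  apply/set_type_cvg; rewrite /from_subspace /= red_ractE//.
  pose F := within (ra_dom red_right) (nbhs (z, g)).
  have near_comp : F [set p | gs (\val p.1) = gr p.2].
    by apply: filterS (withinT _ _) => -[g' z'].
  have : (fun p : Z * G => gmul (\val p.1) p.2) @ F --> gmul (\val z) g.
    apply: gmul_cvg => //; last exact: cvg_snd_within.
    by apply: val_cvg; exact: cvg_fst_within.
  apply: cvg_trans; apply: near_eq_cvg.
  by apply: filterS near_comp => p pc; rewrite red_ractE.
Qed.

Lemma red_left_free : la_free red_left.
Proof.
move=> g z /(congr1 \val)/= gz /(congr1 \val); rewrite red_lactE// => e.
by apply: val_inj; rewrite /= -[LHS](gmulK gz) e gmulV.
Qed.

Lemma red_right_free : ra_free red_right.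
Proof.
move=> z g /= zg /(congr1 \val); rewrite red_ractE// => e.
by rewrite -[LHS](gmulVK zg) e gmulVg.
Qed.

(** If [g z'] tends to [z] and [z'] to [y], then [g], the product of [g z'] with the inverse of
    [z'], tends to [z y^-1]. This product is composable because limits are unique in [G], which
    makes the sources of [z] and [y] agree. *)
Lemma red_left_proper : la_proper red_left.
Proof.
move=> K; rewrite !compact_ultra => cK F UF FD.
have UF' := fmap_ultra (fun p : GA * Z => (la_act red_left p.1 p.2, p.2)) UF.
have FK : F [set p | K (la_act red_left p.1 p.2, p.2)] by apply: filterS FD => p [].
have [[z y] [Kzy Fzy]] := cK _ UF' FK.
have PF : ProperFilter F by case: UF.
have FF : Filter F by case: PF.
have Fdom : F (la_dom red_left) by apply: filterS FD => p [].
have Fcomp : F [set p | gs (\val p.1) = gr (\val p.2)].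
  by apply: filterS Fdom => p /(congr1 \val).
have cv1 : (fun p => \val (red_lact p.1 p.2)) @ F --> \val z.
  by apply: val_cvg; exact: (cvg_comp _ fst Fzy cvg_fst).
have cv2' : snd @ F --> y.
  exact: (cvg_comp _ snd Fzy cvg_snd).
have cv2 : (fun p => \val p.2) @ F --> \val y by apply: val_cvg.
have near_s : F [set p | gs (\val (red_lact p.1 p.2)) = gs (\val p.2)].
  by apply: filterS Fcomp => p pc /=; rewrite red_lactE// gs_mul.
have zy : gs (\val z) = gs (\val y).
  apply: (@cvg_unique _ hG _ (fmap_proper_filter (fun p => gs (\val p.2)) PF)) => /=.
    have : (fun p => gs (\val (red_lact p.1 p.2))) @ F --> gs (\val z).
      by apply: continuous_cvg cv1; exact: gs_continuous.
    by apply: cvg_trans; apply: near_eq_cvg; exact: near_s.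
  by apply: continuous_cvg cv2; exact: gs_continuous.
pose g0 := gmul (\val z) (ginv (\val y)).
have zy' : gs (\val z) = gr (ginv (\val y)) by rewrite gr_inv.
have Ag0 : A g0.
  apply/AE; rewrite /g0 gr_mul// gs_mul// gs_inv.
  by split; apply/Wr/set_valP.
have cvg0 : fst @ F --> (exist _ g0 (mem_set Ag0) : GA).
  apply/set_type_cvg => /=.
  have : (fun p => gmul (\val (red_lact p.1 p.2)) (ginv (\val p.2))) @ F --> g0.
    apply: gmul_cvg => //.
      by apply: continuous_cvg cv2; exact: inv_cont.
    by apply: filterS near_s => p ps /=; rewrite gr_inv.
  apply: cvg_trans; apply: near_eq_cvg; apply: filterS Fcomp => p pc.
  by rewrite red_lactE// gmulK.
exists (exist _ g0 (mem_set Ag0), y); split.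
  have g0y : gs g0 = gr (\val y) by rewrite /g0 gs_mul// gs_inv.
  split; first by apply: val_inj.
  rewrite /= (_ : red_lact _ y = z)//; apply: val_inj.
  by rewrite red_lactE//= /g0 -gmulA ?gmulVg ?gs_inv// -zy gmul_s.
move=> U HU; have : F [set p | U (p.1, p.2)] := @cvg_pair _ _ _ F _ _ FF
  (nbhs_filter _) (nbhs_filter _) fst snd cvg0 cv2' U HU.
by apply: filterS => -[].
Qed.

(** Mirror image: the acting arrow is the inverse of the point times the moved point, and now it is
    the ranges that agree in the limit. *)
Lemma red_right_proper : ra_proper red_right.
Proof.
move=> K; rewrite !compact_ultra => cK F UF FD.
have UF' := fmap_ultra (fun p : Z * G => (ra_act red_right p.1 p.2, p.1)) UF.
have FK : F [set p | K (ra_act red_right p.1 p.2, p.1)] by apply: filterS FD => p [].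
have [[w z] [Kwz Fwz]] := cK _ UF' FK.
have PF : ProperFilter F by case: UF.
have FF : Filter F by case: PF.
have Fcomp : F [set p | gs (\val p.1) = gr p.2] by apply: filterS FD => p [].
have cv1 : (fun p => \val (red_ract p.1 p.2)) @ F --> \val w.
  by apply: val_cvg; exact: (cvg_comp _ fst Fwz cvg_fst).
have cv2' : fst @ F --> z.
  exact: (cvg_comp _ snd Fwz cvg_snd).
have cv2 : (fun p => \val p.1) @ F --> \val z by apply: val_cvg.
have near_r : F [set p | gr (\val (red_ract p.1 p.2)) = gr (\val p.1)].
  by apply: filterS Fcomp => p pc /=; rewrite red_ractE// gr_mul.
have wz : gr (\val w) = gr (\val z).
  apply: (@cvg_unique _ hG _ (fmap_proper_filter (fun p => gr (\val p.1)) PF)) => /=.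
    have : (fun p => gr (\val (red_ract p.1 p.2))) @ F --> gr (\val w).
      by apply: continuous_cvg cv1; exact: gr_cont.
    by apply: cvg_trans; apply: near_eq_cvg; exact: near_r.
  by apply: continuous_cvg cv2; exact: gr_cont.
pose g0 := gmul (ginv (\val z)) (\val w).
have zw : gs (ginv (\val z)) = gr (\val w) by rewrite gs_inv.
have cvg0 : snd @ F --> g0.
  have : (fun p => gmul (ginv (\val p.1)) (\val (red_ract p.1 p.2))) @ F --> g0.
    apply: gmul_cvg => //.
      by apply: continuous_cvg cv2; exact: inv_cont.
    by apply: filterS near_r => p pr /=; rewrite gs_inv.
  apply: cvg_trans; apply: near_eq_cvg; apply: filterS Fcomp => p pc.
  by rewrite red_ractE// gmulVK.
exists (z, g0); split.
  have zg0 : gs (\val z) = gr g0 by rewrite /g0 gr_mul// gr_inv.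
  split=> //.
  rewrite /= (_ : red_ract z _ = w)//; apply: val_inj.
  by rewrite red_ractE//= /g0 gmulA ?gr_inv// gmulV -wz gmul_r.
move=> U HU; have : F [set p | U (p.1, p.2)] := @cvg_pair _ _ _ F _ _ FF
  (nbhs_filter _) (nbhs_filter _) fst snd cv2' cvg0 U HU.
by apply: filterS => -[].
Qed.

Lemma red_commute : actions_commute red_left red_right.
Proof.
split=> [g z /(congr1 \val)/= gz|z h zh|g z h /(congr1 \val)/= gz zh].
- by apply: val_inj; rewrite /= red_lactE// gs_mul.
- by do 2!apply: val_inj; rewrite /= red_ractE// gr_mul.
- by apply: val_inj; rewrite red_ractE !red_lactE ?red_ractE ?gs_mul ?gr_mul// gmulA.
Qed.

Lemma red_orbit_r : exists f : ra_orbit_space red_right -> unit_space GA,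
  homeomorphism f /\ forall z, f (ra_orbit red_right z) = la_r red_left z.
Proof.
have [o c _] := red_left_continuous.
apply: (@quotient_homeomorphism _ _ (ra_orbit_equivRel red_right)
  (la_r red_left)) => //; first exact: la_r_surj.
move=> x y; split=> [/asboolP[g [xg <-]]|].
  by have [_ -> //] := red_commute.
move=> /(congr1 \val)/(congr1 \val)/= xy; apply/asboolP.
have xy' : gs (ginv (\val x)) = gr (\val y) by rewrite gs_inv.
exists (gmul (ginv (\val x)) (\val y)).
have h : gs (\val x) = gr (gmul (ginv (\val x)) (\val y)) by rewrite gr_mul ?gr_inv.
split=> //; apply: val_inj; rewrite red_ractE// gmulA ?gr_inv//.
by rewrite gmulV xy gmul_r.
Qed.

(** Two arrows of [W] with the same source differ on the left by [y x^-1], whose range and source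
    are the ranges of [y] and [x]; so it belongs to [A]. *)
Lemma red_orbit_s : exists f : la_orbit_space red_left -> unit_space G,
  homeomorphism f /\ forall z, f (la_orbit red_left z) = ra_s red_right z.
Proof.
have [o c _] := red_right_continuous.
apply: (@quotient_homeomorphism _ _ (la_orbit_equivRel red_left)
  (ra_s red_right)) => //; first exact: ra_s_surj.
move=> x y; split=> [/asboolP[g [xg <-]]|].
  by have [-> //] := red_commute.
move=> /(congr1 \val)/= xy; apply/asboolP.
have xy' : gs (\val y) = gr (ginv (\val x)) by rewrite gr_inv.
have Ag : A (gmul (\val y) (ginv (\val x))).
  by apply/AE; rewrite gr_mul// gs_mul// gs_inv; split; apply/Wr/set_valP.
have h : gs (gmul (\val y) (ginv (\val x))) = gr (\val x) by rewrite gs_mul ?gs_inv.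
exists (SigSub (mem_set Ag) : GA); split; first exact: val_inj.
apply: val_inj; rewrite red_lactE//= -gmulA ?gs_inv//.
by rewrite gmulVg xy gmul_s.
Qed.

Lemma reduction_lch : closed A -> lch_groupoid GA.
Proof.
move=> cA; split; first by apply: set_type_lch => //; case: lG.
  apply/subspace_continuousP => -[g h] /(congr1 \val)/= gh.
  apply/set_type_cvg; rewrite /from_subspace /= val_sub_mul//.
  pose F := within (@composable GA) (nbhs (g, h)).
  have near_comp : F [set p | gs (\val p.1) = gr (\val p.2)].
    by apply: filterS (withinT _ _) => -[g' z'] /(congr1 \val).
  have : (fun p : GA * GA => gmul (\val p.1) (\val p.2)) @ F -->
      gmul (\val g) (\val h).
    apply: gmul_cvg => //; apply: val_cvg; first exact: cvg_fst_within.
    exact: cvg_snd_within.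
  apply: cvg_trans; apply: near_eq_cvg.
  by apply: filterS near_comp => p pc; rewrite val_sub_mul.
apply: set_type_continuous => g.
apply: continuous_comp; [exact: set_val_continuous|exact: inv_cont].
Qed.

Lemma full_reduction_equivalent : equivalent GA G.
Proof.
have cA : closed A.
  rewrite (_ : A = (@gr G @^-1` W) `&` (@gs G @^-1` W)).
    by apply: closedI; apply: (closed_comp _ cW) => x _;
      [exact: gr_cont|exact: gs_continuous].
  by apply/seteqP; split=> g /AE.
split; [exact: reduction_lch|exact: lG|exists Z, red_left, red_right; split].
- by apply: set_type_lch => //; case: lG.
- split; [exact: red_left_continuous|exact: red_left_free|exact: red_left_proper].
- split; [exact: red_right_continuous|exact: red_right_free|exact: red_right_proper].
- exact: red_commute.
- exact: red_orbit_r.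
- exact: red_orbit_s.
Qed.

End FullReduction.

(** * Contracted paths *)

Lemma sval_inj (T : Type) (P : T -> Prop) : injective (@sval T P).
Proof.
by move=> [x px] [y py] /= xy; subst y; rewrite (Prop_irrelevance px py).
Qed.

Lemma finite_set_bounded (T : Type) (K : set T) (f : T -> nat) : finite_set K ->
  exists n, forall k, K k -> f k <= n.
Proof.
move=> /(finite_image f)/finite_seqP[X XE].
exists (\max_(i <- X) i) => k Kk; apply: leq_bigmax_seq => //.
by have : (f @` K) (f k) by [exists k]; rewrite XE.
Qed.

Section Contraction.
Variables (E : digraph) (A : set (vert E)).
Local Notation F := (contracted_graph A).
Implicit Types (a b c d : finpath E) (z u : gpath E).
Implicit Types (p q r : finpath F) (x t : gpath F).

(** * Flattening of paths and unique decoding *)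

Lemma flat_walk (v : vert F) (s : seq (edge F)) : walk v s ->
  walk (sval v) (flatten [seq fedges (sval f) | f <- s]) /\
  last (sval v) [seq src e | e <- flatten [seq fedges (sval f) | f <- s]] =
  sval (last v [seq src f | f <- s]).
Proof.
elim: s v => [//|b s IH] v /= [<- /IH[ws ls]] /=.
have bE : last (frng (sval b)) [seq src e | e <- fedges (sval b)] = fsrc (sval b).
  by [].
split; last by rewrite map_cat last_cat bE ls.
by apply/walk_cat; split; [exact: finpathP|rewrite bE].
Qed.

Definition flat p : finpath E := FinPath (flat_walk (finpathP p)).1.

Lemma fsrc_flat p : fsrc (flat p) = sval (fsrc p).
Proof. exact: (flat_walk (finpathP p)).2. Qed.

Lemma flat_vpath v : flat (vpath v) = vpath (sval v).
Proof. exact: finpath_eq. Qed.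

Lemma flat_epath e : flat (epath e) = sval e.
Proof. by apply: finpath_eq => //=; rewrite cats0. Qed.

Lemma flat_comp p q : fsrc p = frng q -> fsrc (flat p) = frng (flat q).
Proof. by rewrite fsrc_flat => ->. Qed.

Lemma flat_fapp p q : fsrc p = frng q ->
  flat (fapp p q) = fapp (flat p) (flat q).
Proof.
move=> pq; apply: finpath_eq; first by rewrite !frng_fapp /= frng_fapp.
rewrite (fedges_fapp (flat_comp pq)) /= fedges_fapp//.
by rewrite map_cat flatten_cat.
Qed.

(** Edges of [F] are nonempty paths. Hence the flattened prefixes of an infinite path of [F] become
    arbitrarily long. *)
Lemma flat_len p : flen p <= flen (flat p).
Proof.
case: p => v s w; rewrite /flen /=; elim: s {v w} => //= b s IH.
rewrite size_cat -add1n leq_add//.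
by case: (svalP b).
Qed.

Lemma fsrc_fapp_epath b (e : edge E) : fsrc b = rng e ->
  fsrc (fapp b (epath e)) = src e.
Proof. by move=> be; rewrite fsrc_fapp. Qed.

Lemma onth_fapp_epath b (e : edge E) : fsrc b = rng e ->
  onth (fedges (fapp b (epath e))) (flen b) = Some e.
Proof. by move=> be; rewrite fedges_fapp// onth_cat ltnn subnn. Qed.

Lemma pfx_nth z i (e : edge E) : pedge z i = Some e -> exists c,
  [/\ flen c = i, fsrc c = rng e & pfx (fapp c (epath e)) z].
Proof.
move=> /pfx_take[a [az la ai]].
have [c [e' [ce aE]]] : exists c e', fsrc c = rng e' /\ a = fapp c (epath e').
  by apply: finpath_last; rewrite la.
have lc : flen c = i by move: la; rewrite aE flen_fapp// addn1 => -[].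
by move: ai; rewrite aE -lc onth_fapp_epath// => -[<-]; exists c; rewrite -aE.
Qed.

Lemma nth_pfx z c (e : edge E) : fsrc c = rng e -> pfx (fapp c (epath e)) z ->
  pedge z (flen c) = Some e.
Proof.
move=> ce /pedge_pfx -> ; first exact: onth_fapp_epath.
by rewrite flen_fapp// addn1.
Qed.

(** The condition on indexed edges becomes one on proper nonempty prefixes, which is the form that
    can be compared with the prefix order. *)
Lemma contractedP b : contracted_path A b <->
  [/\ 0 < flen b, A (fsrc b), A (frng b) &
    forall c, fpfx c b -> 0 < flen c < flen b -> ~ A (fsrc c)].
Proof.
split=> -[b0 sb rb H]; split=> //.
  move=> c cb /andP[/finpath_last[d [e [de cE]]] lb].
  rewrite cE fsrc_fapp_epath//; apply: (H (flen d)).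
    by rewrite -[X in X < _]addn1 -(flen_fapp (b := epath e))// -cE.
  move/pfx_fin/pedge_pfx: cb => /= -> //; last first.
    by rewrite cE flen_fapp// addn1.
  by rewrite cE onth_fapp_epath.
move=> i e ib bi.
have [c [lc ce /pfx_fin cb]] := @pfx_nth (GFin b) i e bi.
rewrite -(fsrc_fapp_epath ce); apply: H cb _.
by rewrite flen_fapp// addn1 lc.
Qed.

(** A proper nonempty prefix of [c] has its source outside [A], unlike [b]. *)
Lemma contracted_pfx b c : contracted_path A b -> contracted_path A c ->
  fpfx b c -> b = c.
Proof.
move=> /contractedP[b0 sb _ _] /contractedP[_ _ _ H] bc; apply: fpfx_eq => //.
by rewrite leqNgt; apply/negP => lt; apply: (H b bc) => //; rewrite b0.
Qed.

(** Unique decoding: the first edges of [p] and [q] both flatten to prefixes of [flat q], so they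
    are comparable and hence equal; they are cancelled and the rest goes by induction. In particular
    [flat] is injective. *)
Lemma flat_pfx p q : fpfx (flat p) (flat q) <-> fpfx p q.
Proof.
split=> [|[r [pr ->]]]; last first.
  by exists (flat r); split; [exact: flat_comp|exact: flat_fapp].
have [n] := ubnP (flen p); elim: n p q => // n IH p q lt pq.
have [/flen0 pE|/finpath_first[e [p' [ep pE]]]] := posnP (flen p).
  exists q; rewrite pE.
  have pq' : frng p = frng q.
    by apply: sval_inj; have [d [_ /(congr1 (@frng E))]] := pq; rewrite frng_fapp.
  by rewrite pq' vpath_fapp.
have [/flen0 qE|/finpath_first[f [q' [fq qE]]]] := posnP (flen q).
  move: (fpfx_len pq) (flat_len p); rewrite {1}qE flat_vpath /= leqn0 => /eqP ->.
  by rewrite pE flen_fapp.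
have ep' : fsrc (sval e) = frng (flat p') := congr1 sval ep.
have fq' : fsrc (sval f) = frng (flat q') := congr1 sval fq.
have pE' : flat p = fapp (sval e) (flat p') by rewrite pE flat_fapp// flat_epath.
have qE' : flat q = fapp (sval f) (flat q') by rewrite qE flat_fapp// flat_epath.
have ef : e = f.
  apply: sval_inj.
  have eq : pfx (sval e) (GFin (flat q)).
    by apply/pfx_fin/(fpfx_trans _ pq); rewrite pE'; exact: fpfx_fapp.
  have fq1 : pfx (sval f) (GFin (flat q)).
    by apply/pfx_fin; rewrite qE'; exact: fpfx_fapp.
  have [le|/ltnW le] := leqP (flen (sval e)) (flen (sval f)).
    by apply: contracted_pfx (pfx_comparable eq fq1 le); exact: svalP.
  by apply/esym/contracted_pfx; [exact: svalP|exact: svalP|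
    exact: pfx_comparable fq1 eq le].
subst f.
have /(IH p' q') : flen p' < n.
  by move: lt; rewrite pE flen_fapp// ltnS.
case; last first.
  move=> r [pr q'E]; exists r; rewrite pE fsrc_fapp// fappA//.
  by rewrite qE q'E.
have := pq; rewrite pE' qE'.
move=> [d []]; rewrite fsrc_fapp// => pd; rewrite fappA// => /fapp_inj h.
exists d; split=> //; apply: h => //.
by rewrite frng_fapp.
Qed.

(** A nonempty prefix ending in [A] and having no shorter one of this kind is contracted. *)
Lemma first_return a : A (frng a) -> 0 < flen a -> A (fsrc a) ->
  exists b, contracted_path A b /\ fpfx b a.
Proof.
have [n] := ubnP (flen a); elim: n a => // n IH a lt ra a0 sa.
have [[c [ca /andP[c0 lc] sc]]|H] := pselect (exists c,
  [/\ fpfx c a, 0 < flen c < flen a & A (fsrc c)]).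
  have [||||b [cb bc]] := IH c => //.
  - by rewrite -ltnS; exact: leq_ltn_trans lt.
  - by have [d [_ aE]] := ca; rewrite -(frng_fapp c d) -aE.
  by exists b; split=> //; exact: fpfx_trans ca.
exists a; split; last exact: fpfx_refl.
by apply/contractedP; split=> // c ca lc sc; apply: H; exists c.
Qed.

Lemma flat_surj a : A (frng a) -> A (fsrc a) -> exists p, flat p = a.
Proof.
have [n] := ubnP (flen a); elim: n a => // n IH a lt ra sa.
have [/flen0 aE|a0] := posnP (flen a).
  by exists (@vpath F (exist _ (frng a) ra)); rewrite flat_vpath.
have [b [cb [d [bd aE]]]] := first_return ra a0 sa.
have [b0 sb _ _] := cb.
have [||| p pd] := IH d.
- by move: lt; rewrite aE flen_fapp//; lia.
- by rewrite -bd.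
- by move: sa; rewrite aE fsrc_fapp.
exists (fapp (@epath F (exist _ b cb)) p).
have bp : @fsrc F (@epath F (exist _ b cb)) = frng p.
  by apply: sval_inj; rewrite /= bd -pd.
by rewrite flat_fapp// flat_epath pd.
Qed.

(** The range of [z] is exempt: this covers a path that leaves a vertex of [A] for good, and also
    every path of length 0. *)
Definition stays z := forall c, pfx c z -> 0 < flen c -> ~ A (fsrc c).

Lemma not_stays z : A (prng z) -> ~ stays z ->
  exists b, contracted_path A b /\ pfx b z.
Proof.
move=> rz /existsNP[c /not_implyP[cz /not_implyP[c0 /contrapT sc]]].
have [|b [cb bc]] := @first_return c _ c0 sc; first by rewrite (pfx_rng cz).
by exists b; split=> //; exact: fpfx_pfx cz.
Qed.

(* [x] records the successive visits of [z] to [A]. *)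
Definition flat_rel z x := forall p, pfx p x <-> pfx (flat p) z.

Lemma flat_rel_prng z x : flat_rel z x -> sval (prng x) = prng z.
Proof.
move=> zx; have /zx : pfx (vpath (prng x)) x by exact/pfx_vpath.
by rewrite flat_vpath => /pfx_vpath.
Qed.

Lemma flat_rel_exists z : A (prng z) -> exists x, flat_rel z x.
Proof.
move=> Az.
have [|||x xP] := @chain_gpath F [set p | pfx (flat p) z]; last first.
- by exists x => p; rewrite -xP.
- move=> p q /= pz qz le.
  have [/(pfx_comparable pz qz)/flat_pfx//|] := leqP (flen (flat p)) (flen (flat q)).
  move=> /ltnW/(pfx_comparable qz pz)/flat_pfx qp.
  by rewrite (fpfx_eq qp le); exact: fpfx_refl.
- by move=> p q /flat_pfx; exact: fpfx_pfx.
- exists (@vpath F (exist _ (prng z) Az)) => /=.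
  by rewrite flat_vpath; exact/pfx_vpath.
Qed.

(** A path comparable with [p] is either a prefix of [p], where both sides hold, or an extension of
    [p], where [p] cancels. *)
Lemma flat_rel_papp p u t : fsrc p = prng t -> flat_rel u t ->
  flat_rel (papp (flat p) u) (papp p t).
Proof.
move=> pt ut q; have pu : fsrc (flat p) = prng u.
  by rewrite fsrc_flat pt (flat_rel_prng ut).
have aux : fpfx p q -> pfx q (papp p t) <-> pfx (flat q) (papp (flat p) u).
  move=> [r [pr ->]]; have pr' := flat_comp pr.
  by rewrite flat_fapp// (pfx_papp2 pr pt) (pfx_papp2 pr' pu).
have pt' := pfx_papp pt; have pu' := pfx_papp pu.
split=> qt.
  have [/(pfx_comparable qt pt')/flat_pfx|/ltnW] := leqP (flen q) (flen p).
    by move=> /fpfx_pfx; apply.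
  by move=> /(pfx_comparable pt' qt)/aux <-.
have [/(pfx_comparable qt pu')/flat_pfx|] := leqP (flen (flat q)) (flen (flat p)).
  by move=> /fpfx_pfx; apply.
by move=> /ltnW/(pfx_comparable pu' qt)/flat_pfx/aux ->.
Qed.

(** If the remainder [u] returned to [A], its first return would be an edge of [F] extending [p]. *)
Lemma flat_rel_fin z p : flat_rel z (GFin p) ->
  exists u, [/\ fsrc (flat p) = prng u, z = papp (flat p) u & stays u].
Proof.
move=> zp; have [u [pu zE]] := (zp p).1 ((pfx_fin _ _).2 (fpfx_refl _)).
exists u; split=> //; apply: contrapT => /not_stays[|b [cb bu]].
  by rewrite -pu fsrc_flat; exact: svalP.
pose e : edge F := exist _ b cb.
have pe : fsrc p = rng e.
  by apply: sval_inj; rewrite -fsrc_flat pu /= (pfx_rng bu).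
have : pfx (fapp p (epath e)) (GFin p).
  apply/zp; rewrite zE flat_fapp//; apply/pfx_papp2 => //; first exact: flat_comp.
  by rewrite flat_epath.
by move=> /pfx_fin/fpfx_len; rewrite flen_fapp// addn1 ltnn.
Qed.

Lemma flat_rel_vpath v u : sval v = prng u -> stays u ->
  flat_rel u (GFin (@vpath F v)).
Proof.
move=> vu su p; split=> [/pfx_fin pv|pu].
  rewrite (fpfx_eq pv (leq0n _)) flat_vpath; exact/pfx_vpath.
apply/pfx_fin; have [/flen0 pE|/finpath_first[e [q [eq pE]]]] := posnP (flen p).
  rewrite pE (_ : frng p = v); first exact: fpfx_refl.
  by apply: sval_inj; rewrite vu -(pfx_rng pu).
have [e0 se _ _] := svalP e; exfalso; apply: (su (sval e)) => //.
apply: fpfx_pfx pu; rewrite pE flat_fapp// flat_epath.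
by apply: fpfx_fapp; exact: (congr1 sval eq).
Qed.

End Contraction.

(** * Boundary paths of the contracted graph *)

Lemma card_eq_I1 (U : Type) (B : set U) : B #= `I_1 -> is_subset1 B.
Proof.
move=> /card_eqP[f] u v Bu Bv.
have fE : f (SigSub (mem_set Bu)) = f (SigSub (mem_set Bv)).
  apply: val_inj; have := set_valP (f (SigSub (mem_set Bu))).
  have := set_valP (f (SigSub (mem_set Bv))).
  by rewrite /= !ltnS !leqn0 => /eqP -> /eqP ->.
have := @inj _ _ _ f _ _ (in_setT _) (in_setT _) fE.
by move=> /(congr1 \val).
Qed.

Lemma finite_is_subset1 (U : Type) (B : set U) : is_subset1 B -> finite_set B.
Proof.
move=> B1; have [->|/set0P[u Bu]] := eqVneq B set0; first exact: finite_set0.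
by apply: sub_finite_set (finite_set1 u) => v Bv; exact: B1.
Qed.

Section BoundaryPaths.
Variables (E : digraph) (A : set (vert E)).
Local Notation F := (contracted_graph A).
Local Notation T := (complement_graph A).
Hypothesis noheads : forall x : infpath E, ~ is_head x.
Hypothesis singA : @singular E `<=` A.
Hypothesis acyclicT : acyclic T.
Hypothesis T1 : forall v, A v ->
  is_subset1 [set y : infpath E | irng y = v /\ forall i, ~ A (src (y i))].
Hypothesis T3 : forall x : infpath T,
  forall i, emits (rng (sval (x i))) #= `I_1.
Hypothesis T4 : forall x : infpath T,
  forall e : edge E, src e = sval (irng x) -> finite_set (receives (rng e)).
Implicit Types (a b c d : finpath E) (z u : gpath E).
Implicit Types (p q r : finpath F) (x t : gpath F).

Lemma complement_infpath (y : infpath E) : (forall i, ~ A (rng (y i))) ->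
  (forall i, ~ A (src (y i))) -> exists x : infpath T, forall i, sval (x i) = y i.
Proof.
move=> yr ys; pose f i : edge T := exist _ (y i) (conj (yr i) (ys i)).
have fP i : src (f i) = rng (f i.+1) by apply: sval_inj; exact: infpathP.
by exists (InfPath fP).
Qed.

Lemma stays_inf (y : infpath E) :
  stays A (GInf y) <-> forall i, ~ A (src (y i)).
Proof.
split=> [H i|H c cy].
  have [c [lc ce cy]] := @pfx_nth E (GInf y) i (y i) erefl.
  by rewrite -(fsrc_fapp_epath ce); apply: H cy _; rewrite flen_fapp// addn1.
move=> /finpath_last[d [e [de cE]]]; rewrite cE in cy *.
by rewrite fsrc_fapp_epath//; have [<-] := nth_pfx de cy.
Qed.

Lemma stays_cases z : boundary z -> stays A z ->
  z = GFin (vpath (prng z)) /\ singular (prng z) \/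
  exists2 y, z = GInf y & forall i, ~ A (src (y i)).
Proof.
case: z => [y _ /stays_inf|a Xa sa]; first by right; exists y.
have [/flen0 aE|a0] := posnP (flen a); last first.
  by case: (sa a) => //; [exact/pfx_fin/fpfx_refl|exact: singA].
by left; split; [rewrite [in LHS]aE|move: Xa; rewrite aE].
Qed.

(** The tail starts at [n.+1] because the range of [y 0] may lie in [A]; every later range is the
    source of the preceding edge. *)
Lemma complement_tail (y : infpath E) n : (forall i, ~ A (src (y i))) ->
  exists x : infpath T, forall i, sval (x i) = y (n.+1 + i).
Proof.
move=> ys.
have sP i : src (y (n.+1 + i)) = rng (y (n.+1 + i.+1)).
  by rewrite addnS; exact: infpathP.
apply: (@complement_infpath (InfPath sP)) => i //=.
by rewrite addSn -infpathP.
Qed.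

(** (T4) is applied to the edge [y 0], whose source is the range of the tail of [y] in [T]. *)
Lemma stays_finite_receiver (y : infpath E) : (forall i, ~ A (src (y i))) ->
  finite_set (receives (irng y)).
Proof.
move=> /(complement_tail 0)[x xy]; apply: (T4 (x := x)).
by rewrite /irng /= xy infpathP.
Qed.

(** A continuation that never returns is trivial at a singular vertex, or infinite. Two infinite
    ones agree by (T1). An infinite one excludes the trivial one, since its vertex receives [y 0]
    and only finitely many edges. *)
Lemma stays_unique z z' : boundary z -> boundary z' -> stays A z -> stays A z' ->
  A (prng z) -> prng z = prng z' -> z = z'.
Proof.
wlog: z z' / (exists2 y, z = GInf y & forall i, ~ A (src (y i))) \/
    (z = GFin (vpath (prng z)) /\ z' = GFin (vpath (prng z'))).
  move=> wl Xz Xz' sz sz' Az zz'.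
  have [[zE sgz]|[y zE ys]] := stays_cases Xz sz; last first.
    by apply: wl => //; left; exists y.
  have [[zE' _]|[y zE' ys]] := stays_cases Xz' sz'; first by apply: wl => //; right.
  by apply/esym; apply: wl; rewrite -?zz'//; left; exists y.
case=> [[y zE ys]|[-> ->]] Xz Xz' sz sz' Az; last by move=> /= ->.
move=> zz'; have [[zE' [sr|ir]]|[y' zE' ys']] := stays_cases Xz' sz'.
- have : receives (prng z') (y 0) by rewrite -zz' zE.
  by rewrite sr.
- case: ir; have /= := stays_finite_receiver ys.
  by rewrite -zz' zE.
rewrite zE zE'; congr GInf; apply: (T1 Az); rewrite ?zE//=.
by split=> //; rewrite -[RHS]/(prng (GInf y)) -zE zz' zE'.
Qed.

(** Over an infinite [x], every prefix of [z] is a prefix of some [flat p], as flattening does not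
    shorten. Over a finite [x], the remainders of the two paths never return to [A], so they
    coincide. *)
Lemma flat_rel_inj z z' x : boundary z -> boundary z' -> A (prng z) ->
  flat_rel z x -> flat_rel z' x -> z = z'.
Proof.
move=> Xz Xz' Az zx zx'; case: x zx zx' => [y|p] zx zx'.
  have aux z1 z2 c : flat_rel z1 (GInf y) -> flat_rel z2 (GInf y) ->
      pfx c z1 -> pfx c z2.
    move=> zx1 zx2 cz.
    have [p [py lp _]] := @pfx_take F (GInf y) (flen c) (y (flen c)) erefl.
    apply: (fpfx_pfx _ ((zx2 p).1 py)); apply: pfx_comparable cz ((zx1 p).1 py) _.
    by apply: leq_trans (flat_len p); rewrite lp.
  by apply: pfx_ext => c; split; exact: aux.
have [u [pu zE su]] := flat_rel_fin zx.
have [u' [pu' zE' su']] := flat_rel_fin zx'.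
rewrite zE zE'; congr papp.
apply: stays_unique => //; rewrite -?pu//.
- by rewrite zE boundary_papp in Xz.
- by rewrite zE' boundary_papp in Xz'.
- by rewrite fsrc_flat; exact: svalP.
Qed.

(** Extend [e] to a boundary path. Either it returns to [A] and its first return is contracted, or
    it is infinite, since a finite boundary path ends in [A]. *)
Lemma edge_extends (e : edge E) : A (rng e) ->
  (exists b, contracted_path A b /\ fpfx (epath e) b) \/
  exists2 y : infpath E, y 0 = e & forall i, ~ A (src (y i)).
Proof.
move=> Ae; have [z [Xz ez]] := boundary_exists (src e).
have ez' : fsrc (epath e) = prng z by [].
pose w := papp (epath e) z; have Xw : boundary w by rewrite boundary_papp.
have rw : prng w = rng e by rewrite prng_papp.
have ew : pfx (epath e) w by exact: pfx_papp.
have [sw|nsw] := pselect (stays A w).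
  have [[wE _]|[y wE ys]] := stays_cases Xw sw.
    by move: ew; rewrite wE => /pfx_fin/fpfx_len.
  right; exists y => //; have := pedge_pfx (i := 0) ew.
  by rewrite wE /= => /(_ isT) [].
have [|b [cb bw]] := not_stays _ nsw; first by rewrite rw.
by left; exists b; split=> //; apply: pfx_comparable ew bw _; case: cb.
Qed.

Lemma acyclic_complement (x : infpath T) (y : infpath E) :
  (forall i, sval (x i) = y i) -> acyclic_infpath y.
Proof.
move=> xy i j ij; rewrite -!xy => e.
have tP n : src (x (i + n)) = rng (x (i + n.+1)) by rewrite addnS; exact: infpathP.
have [c [lc ce cx]] := @pfx_nth T (GInf (InfPath tP)) (j - i) _ erefl.
apply: (@acyclicT (fapp c (epath (x (i + (j - i)))))).
  by rewrite flen_fapp// addn1.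
rewrite (pfx_rng cx) fsrc_fapp_epath// subnKC//.
by apply: sval_inj; rewrite /= /irng /= addn0 e.
Qed.

(* With finitely many edges into [v], all but finitely many vertices of [y] would
   receive only one edge: a second one extends to a contracted path into [v],
   which is long, or else to a second path contradicting (T1). So a tail of [y]
   would be a head. *)
Lemma stays_infinite_receiver (v : vert F) (y : infpath E) :
  irng y = sval v -> (forall i, ~ A (src (y i))) -> infinite_receiver v.
Proof.
move=> yv ys fv.
have [N NP] := finite_set_bounded (fun b : edge F => flen (sval b)) fv.
have [x xy] := complement_tail N ys.
have tP i : src (y (N.+1 + i)) = rng (y (N.+1 + i.+1)).
  by rewrite addnS; exact: infpathP.
have [i [f [fi fy]]] : exists i f, rng f = rng (y (N.+1 + i)) /\ f <> y (N.+1 + i).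
  apply: contrapT => H; apply: (@noheads (InfPath tP)); split=> [|i|i] /=.
  - exact: (@acyclic_complement x (InfPath tP)).
  - apply/seteqP; split=> [f /= fi|f -> //]; apply: contrapT => fy.
    by apply: H; exists i, f.
  (* The source of an edge of the tail is the range of the next edge, whence the index [i.+1]. *)
  - have := T3 x i.+1; rewrite xy -tP => /card_eq_I1 e1.
    by apply/seteqP; split=> [e /= es|e -> //]; exact: e1.
have [c [lc ce cy]] := @pfx_nth E (GInf y) (N + i) _ erefl.
set a := fapp c _ in cy.
have la : flen a = (N + i).+1 by rewrite /a flen_fapp// addn1 lc.
have af : fsrc a = rng f by rewrite /a fsrc_fapp_epath// fi addSn -infpathP.
have [z [Xz fz]] := boundary_exists (src f).
have afz : fsrc (fapp a (epath f)) = prng z by rewrite fsrc_fapp.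
pose w := papp (fapp a (epath f)) z.
have Xw : boundary w by rewrite boundary_papp.
have afw : pfx (fapp a (epath f)) w by exact: pfx_papp.
have aw : pfx a w by exact: pfx_trans afw.
have rw : prng w = sval v by rewrite -(pfx_rng aw) (pfx_rng cy).
have [sw|nsw] := pselect (stays A w).
  have [[wE _]|[y' wE ys']] := stays_cases Xw sw.
    by have := aw; rewrite wE => /pfx_fin/fpfx_len; rewrite la.
  have yy : y' = y.
    apply: (T1 (svalP v)) => //; split=> //.
    by rewrite -rw wE.
  by apply: fy; have := nth_pfx af afw; rewrite wE yy la => -[<-].
have [|b [cb bw]] := not_stays _ nsw; first by rewrite rw; exact: svalP.
(* Along [y] there is no return to [A], so [b] runs past [a] and exceeds the bound [N]. *)
have [le|lt] := leqP (flen b) (flen a).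
  have [b0 sb _ _] := cb; apply: ((stays_inf y).2 ys b) => //.
  exact: fpfx_pfx (pfx_comparable bw aw le) cy.
have : receives v (exist _ b cb : edge F).
  by apply: sval_inj; rewrite /= (pfx_rng bw).
by move=> /NP /=; rewrite leqNgt (leq_trans _ lt)// la; lia.
Qed.

(** Let [p] end at [v]. If the rest of [z] is infinite, [v] is an infinite receiver of [F].
    Otherwise [v] is singular in [E]: no contracted path has a source of [E] as its range, and at an
    infinite receiver every edge is the first edge of some contracted path. *)
Lemma flat_rel_boundary z x : boundary z -> A (prng z) -> flat_rel z x -> boundary x.
Proof.
move=> Xz Az; case: x => // p zp.
have [u [pu zE su]] := flat_rel_fin zp.
have Xu : boundary u by rewrite zE boundary_papp in Xz.
have puv : sval (fsrc p) = prng u by rewrite -pu fsrc_flat.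
have [[_ sg]|[y uE ys]] := stays_cases Xu su; last first.
  by right; apply: (@stays_infinite_receiver _ y) => //; rewrite puv uE.
rewrite -puv in sg; case: sg => [sg|ir] /=.
  left; rewrite /is_source -subset0 => b bp.
  have [b0 _ _ _] := svalP b; have [e [c [_ bE]]] := finpath_first b0.
  have : receives (sval (fsrc p)) e.
    by rewrite /receives /= -bp /= bE frng_fapp.
  by rewrite sg.
right=> fp; apply: (ir); have [[e0 re0]|none] :=
    pselect (exists e, receives (sval (fsrc p)) e); last first.
  rewrite (_ : receives _ = set0); first exact: finite_set0.
  by rewrite -subset0 => e re; apply: none; exists e.
(* The map sends a contracted path to its first edge; [e0] is only the default value of [head]. *)
apply: sub_finite_set
  (finite_image (fun b : edge F => head e0 (fedges (sval b))) fp) => e re.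
have [|[b [cb eb]]|[y ye ys]] := @edge_extends e.
- by rewrite re; exact: svalP.
- exists (exist _ b cb : edge F).
    apply: sval_inj; rewrite /= -re.
    by have [d [_ ->]] := eb; rewrite frng_fapp.
  have [d [ed bE]] := eb.
  by have /(congr1 (head e0)) := congr1 (@fedges E) bE; rewrite fedges_fapp.
- by case: ir; have := stays_finite_receiver ys; rewrite /irng ye re.
Qed.

(** The tree consists of the prefixes [a] of contracted paths into [v], and [B a] collects those
    that pass through [a]. A node with infinite [B a] has a nonsingular source, hence finitely many
    children, and one of these again has an infinite [B]. *)
Lemma konig (v : vert F) : ~ singular (sval v) -> infinite_receiver v ->
  exists2 y : infpath E, irng y = sval v & forall i, ~ A (src (y i)).
Proof.
move=> nsv iv.
pose B a := [set b : edge F | receives v b /\ fpfx a (sval b)].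
have step a : exists b, fpfx a b /\ (infinite_set (B a) ->
    infinite_set (B b) /\ flen b = (flen a).+1).
  have [iB|fB] := pselect (infinite_set (B a)); last first.
    by exists a; split; [exact: fpfx_refl|].
  (* If [a] is nonempty and ends in [A], the only contracted path through [a] can be [a] itself. *)
  have nsa : ~ singular (fsrc a).
    have [/flen0 aE|a0] := posnP (flen a).
      have [b [bv ab]] : B a !=set0.
        by apply/set0P/eqP => B0; apply: iB; rewrite B0; exact: finite_set0.
      have ra : frng a = sval v.
        by rewrite -bv /=; have [d [_ ->]] := ab; rewrite frng_fapp.
      by rewrite aE /fsrc /= ra.
    move=> /singA sa; apply: iB.
    apply: (@sub_finite_set _ _ [set b : edge F | sval b = a]); last first.
      by apply: finite_is_subset1 => b c /= <- /sval_inj.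
    move=> b [_ ab] /=; apply/esym/fpfx_eq => //; rewrite leqNgt; apply/negP => lt.
    have /contractedP[_ _ _ H] := svalP b.
    by apply: (H a) => //; rewrite a0.
  have [e [ae iBe]] : exists e, fsrc a = rng e /\ infinite_set (B (fapp a (epath e))).
    apply: contrapT => H; apply: iB.
    apply: (@sub_finite_set _ _ ([set b : edge F | sval b = a] `|`
        \bigcup_(e in receives (fsrc a)) B (fapp a (epath e)))).
      move=> b [bv ab]; have [bE|[e []]] := pfx_step ((pfx_fin _ _).2 ab).
        by left; case: bE.
      by move=> ae /pfx_fin abe; right; exists e.
    rewrite finite_setU; split.
      by apply: finite_is_subset1 => b c /= <- /sval_inj.
    apply: bigcup_finite.
      by apply: contrapT => ?; apply: nsa; right.
    move=> e re; apply: contrapT => iBe.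
    by apply: H; exists e; split; [exact: esym re|].
  exists (fapp a (epath e)); split; first exact: fpfx_fapp.
  by move=> _; split=> //; rewrite flen_fapp// addn1.
have [f fP] := choice step; pose s n := iter n f (vpath (sval v)).
have sP n : infinite_set (B (s n)) /\ flen (s n) = n.
  elim: n => [|n [iB ln]]; last first.
    have [_ /(_ iB)[iB' lf]] := fP (s n); split; first exact: iB'.
    by rewrite /s iterS lf ln.
  split=> //; apply: sub_infinite_set iv => b bv; split=> //.
  by exists (sval b); rewrite /s /= -bv vpath_fapp.
have [z zP] := iter_gpath (vpath (sval v)) (fun a => (fP a).1).
have sz n : pfx (s n) z by apply/zP; exists n; exact: fpfx_refl.
have zv : prng z = sval v by rewrite -(pfx_rng (sz 0)).
case: z zP sz zv => [y|a] zP sz zv; last first.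
  by have /pfx_fin/fpfx_len := sz (flen a).+1; rewrite (sP _).2 ltnn.
exists y => //; apply/stays_inf => c cy c0 sc.
have [n cn] := (zP c).1 cy.
(* Level [n.+1] rather than [n], so that [c] is a proper prefix of a contracted path. *)
have cs : fpfx c (s n.+1) by apply: fpfx_trans cn (fP _).1.
have [b [bv sb]] : B (s n.+1) !=set0.
  apply/set0P/eqP => B0; have := (sP n.+1).1; apply.
  by rewrite B0; exact: finite_set0.
have /contractedP[_ _ _ H] := svalP b.
apply: (H c) => //; first exact: fpfx_trans sb.
rewrite c0 (leq_trans _ (fpfx_len sb))// (sP _).2 ltnS.
by rewrite -[X in _ <= X](sP n).2; exact: fpfx_len.
Qed.

(** A finite [p] is completed by a boundary path [u] that never returns: the trivial one if the end
    of [p] is singular in [E], otherwise an infinite one. The latter comes from an edge without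
    contracted extension if the end of [p] is a source of [F], and from [konig] if it is an infinite
    receiver of [F]. For an infinite [x], the flattened prefixes form a chain. *)
Lemma flat_rel_surj x : boundary x ->
  exists z, [/\ boundary z, A (prng z) & flat_rel z x].
Proof.
case: x => [y _|p Xp]; last first.
  have [u [Xu pu su]] : exists u,
      [/\ boundary u, prng u = sval (fsrc p) & stays A u].
    have [sg|nsg] := pselect (singular (sval (fsrc p))).
      exists (GFin (vpath (sval (fsrc p)))); split=> // c /pfx_fin/fpfx_len /=.
      by rewrite leqn0 => /eqP ->.
    have [e re] : exists e, receives (sval (fsrc p)) e.
      apply: contrapT => H; apply: nsg; left; rewrite /is_source -subset0 => e re.
      by apply: H; exists e.
    have [y yv ys] : exists2 y : infpath E,
        irng y = sval (fsrc p) & forall i, ~ A (src (y i)).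
      case: Xp => [sp|]; last exact: konig.
      have [|[b [cb eb]]|[y ye ys]] := @edge_extends e.
      - by rewrite re; exact: svalP.
      - have : receives (fsrc p) (exist _ b cb : edge F).
          apply: sval_inj; rewrite /= -re.
          by have [d [_ ->]] := eb; rewrite frng_fapp.
        by rewrite sp.
      - by exists y => //; rewrite /irng ye.
    by exists (GInf y); split=> //; exact/stays_inf.
  have pu' : fsrc (flat p) = prng u by rewrite fsrc_flat pu.
  exists (papp (flat p) u); rewrite boundary_papp// prng_papp//; split=> //.
    exact: (svalP (frng p)).
  rewrite -[in X in flat_rel _ X](fapp_vpath p) -papp_fin//.
  by apply: flat_rel_papp => //; exact: flat_rel_vpath.
have py n : exists p, pfx p (GInf y) /\ n < flen p.
  have [p [py lp _]] := @pfx_take F (GInf y) n (y n) erefl.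
  by exists p; rewrite lp.
have cmp p q : pfx p (GInf y) -> pfx q (GInf y) -> flen p <= flen q ->
    fpfx (flat p) (flat q).
  by move=> p1 q1 le; apply/flat_pfx; exact: (pfx_comparable p1 q1 le).
have [|||z zP] := @chain_gpath E [set a | exists p, pfx p (GInf y) /\ fpfx a (flat p)].
- by have [p [p1 _]] := py 0; exists (flat p), p; split=> //; exact: fpfx_refl.
- by move=> a b ab [p [p1 bp]]; exists p; split=> //; exact: fpfx_trans bp.
- move=> a b [p [p1 ap]] [q [q1 bq]] le.
  have [pq|/ltnW qp] := leqP (flen p) (flen q).
    have aq := fpfx_trans ap (cmp _ _ p1 q1 pq).
    exact: (pfx_comparable ((pfx_fin _ _).2 aq) ((pfx_fin _ _).2 bq) le).
  have bp := fpfx_trans bq (cmp _ _ q1 p1 qp).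
  exact: (pfx_comparable ((pfx_fin _ _).2 ap) ((pfx_fin _ _).2 bp) le).
have fz p : pfx p (GInf y) -> pfx (flat p) z.
  by move=> p1; apply/zP; exists p; split=> //; exact: fpfx_refl.
exists z; split.
- case: z zP fz => // c zP fz.
  have [p [p1 lp]] := py (flen c).
  have /pfx_fin/fpfx_len := fz p p1.
  by rewrite leqNgt (leq_trans lp)// flat_len.
- have [p [p1 _]] := py 0; rewrite -(pfx_rng (fz _ p1)).
  exact: (svalP (frng p)).
- move=> p; split=> [/fz//|/zP[q [q1 /flat_pfx pq]]].
  exact: fpfx_pfx pq q1.
Qed.

End BoundaryPaths.

(** * Arrows of the pointed groupoid *)

Section Arrows.
Variables (E : digraph) (A : set (vert E)).
Local Notation F := (contracted_graph A).
Local Notation T := (complement_graph A).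
Hypothesis noheads : forall x : infpath E, ~ is_head x.
Hypothesis singA : @singular E `<=` A.
Hypothesis acyclicT : acyclic T.
Hypothesis T1 : forall v, A v ->
  is_subset1 [set y : infpath E | irng y = v /\ forall i, ~ A (src (y i))].
Hypothesis T2 : forall x : infpath T, reaches (sval (irng x)) A.
Hypothesis T3 : forall x : infpath T,
  forall i, emits (rng (sval (x i))) #= `I_1.
Hypothesis T4 : forall x : infpath T,
  forall e : edge E, src e = sval (irng x) -> finite_set (receives (rng e)).
Implicit Types (a b c d : finpath E) (z u : gpath E) (g : garrow E).
Implicit Types (p q r : finpath F) (x t : gpath F) (h : garrow F).

(** A finite boundary path ends at a singular vertex, which lies in [A]. *)
Lemma avoids_complement z : boundary z -> (forall c, pfx c z -> ~ A (fsrc c)) ->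
  exists x : infpath T, exists2 y, z = GInf y & forall i, sval (x i) = y i.
Proof.
move=> Xz nz; have sz : stays A z by move=> c cz _; exact: nz.
have nA : ~ A (prng z) by apply: (nz (vpath (prng z))); exact/pfx_vpath.
have [[_ /singA//]|[y zE ys]] := stays_cases singA Xz sz.
have yr i : ~ A (rng (y i)).
  by case: i => [|i]; rewrite -?infpathP//; move: nA; rewrite zE.
by have [x xy] := complement_infpath yr ys; exists x, y.
Qed.

(* When the common tail of [g] lies in [T], the last edges of [a] and [b] coincide
   by (T3) and can be moved to the tail. *)
Lemma arrow_factor g : A (prng (ga_r g)) -> A (prng (ga_s g)) ->
  exists p q, fsrc p = fsrc q /\ cylinder (flat p) (flat q) g.
Proof.
move=> Ar As.
suff [a [b [gab sa]]] : exists a b, cylinder a b g /\ A (fsrc a).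
  have ab := cylinder_src gab.
  have [||p pa] := @flat_surj E A a => //.
    by rewrite (pfx_rng (cylinder_pfxr gab)).
  have [||q qb] := @flat_surj E A b; rewrite -?ab//.
    by rewrite (pfx_rng (cylinder_pfxs gab)).
  exists p, q; rewrite pa qb; split=> //.
  by apply: sval_inj; rewrite -!fsrc_flat pa qb.
have [a [b gab]] := cylinder_exists g.
have [n] := ubnP (flen a); elim: n a b gab => // n IH a b gab lt.
have /cylinderP[z [az bz Xz [rg kg sg]]] := gab.
have [[c [cz sc]]|nz] := pselect (exists c, pfx c z /\ A (fsrc c)).
  have ac : fsrc a = frng c by rewrite az (pfx_rng cz).
  exists (fapp a c), (fapp b c); rewrite fsrc_fapp//; split=> //.
  apply/cylinder_fapp => //; first by rewrite -ac az.
  by split=> //; rewrite rg; exact/pfx_papp2.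
have [c cz|x [y zE xy]] := avoids_complement Xz.
  by move=> sc; apply: nz; exists c.
have nA v : v = prng z -> ~ A v.
  by move=> -> Av; apply: nz; exists (vpath (prng z)); split=> //; exact/pfx_vpath.
have [a0|/finpath_last[a' [e [ae aE]]]] := posnP (flen a).
  case: (nA (frng a)); last by rewrite (pfx_rng (cylinder_pfxr gab)).
  by rewrite -az (flen0 a0).
have [b0|/finpath_last[b' [e' [be bE]]]] := posnP (flen b).
  case: (nA (frng b)); last by rewrite (pfx_rng (cylinder_pfxs gab)).
  by rewrite -bz (flen0 b0).
have ee : e' = e.
  apply: (card_eq_I1 (T3 x 0)); rewrite /emits /= xy.
    by rewrite -(fsrc_fapp_epath be) -bE bz zE.
  by rewrite -(fsrc_fapp_epath ae) -aE az zE.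
rewrite ee in be bE; apply: (IH a' b').
  by move: gab; rewrite aE bE => /cylinder_fapp[].
by move: lt; rewrite aE flen_fapp// addn1 ltnS.
Qed.

(** Degrees cannot be compared directly, as flattening changes lengths; the common pair [p], [q]
    fixes both. *)
Definition flat_arrow g h := [/\ flat_rel (ga_r g) (ga_r h),
  flat_rel (ga_s g) (ga_s h) &
  exists p q, cylinder p q h /\ cylinder (flat p) (flat q) g].

(** Cylinders around one arrow are nested, so each is compared with the given pair [p0], [q0].
    Nesting of flattened cylinders is carried back to [F] by injectivity of [flat]. *)
Lemma flat_arrow_cylinder g h p q : flat_arrow g h -> fsrc p = fsrc q ->
  cylinder p q h <-> cylinder (flat p) (flat q) g.
Proof.
move=> [rr ss [p0 [q0 [h0 g0]]]] pq.
have h0s := cylinder_src h0.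
split=> H.
  have [/(cylinder_nested H h0)|/ltnW/(cylinder_nested h0 H)] := leqP (flen p) (flen p0).
    move=> [e [pe qe p0E q0E]]; move: g0; rewrite p0E q0E !flat_fapp//.
    by apply: cylinder_sub; exact: flat_comp.
  move=> [e [pe qe pE qE]]; rewrite pE qE !flat_fapp//.
  apply/cylinder_fapp; [exact: flat_comp|exact: flat_comp|split=> //].
  by rewrite -flat_fapp// -pE; apply/rr; exact: cylinder_pfxr H.
have pr : pfx p (ga_r h) by apply/rr; exact: cylinder_pfxr H.
have qs : pfx q (ga_s h) by apply/ss; exact: cylinder_pfxs H.
have pr0 := cylinder_pfxr h0; have qs0 := cylinder_pfxs h0.
have k1 := cylinder_deg g0; have k2 := cylinder_deg H.
have [le|/ltnW le] := leqP (flen p) (flen p0).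
  have [e [pe p0E]] := pfx_comparable pr pr0 le.
  have qe : fsrc q = frng e by rewrite -pq.
  suff qE : q0 = fapp q e.
    by move: h0; rewrite p0E qE => /cylinder_fapp[].
  have q0' : flat q0 = flat (fapp q e).
    have [|d []] := cylinder_nested H g0.
      by rewrite p0E flat_fapp// flen_fapp ?leq_addr//; exact: flat_comp.
    move=> pd qd; rewrite p0E flat_fapp// => /fapp_inj<- //; last exact: flat_comp.
    by rewrite flat_fapp.
  apply: fpfx_eq; first by apply/flat_pfx; rewrite q0'; exact: fpfx_refl.
  by apply: fpfx_len; apply/flat_pfx; rewrite q0'; exact: fpfx_refl.
have [e [pe pE]] := pfx_comparable pr0 pr le.
have qe : fsrc q0 = frng e by rewrite -h0s.
suff qE : q = fapp q0 e.
  by rewrite pE qE; apply/cylinder_fapp => //; rewrite -pE.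
have q0' : flat q = flat (fapp q0 e).
  have [|d []] := cylinder_nested g0 H.
    by rewrite pE flat_fapp// flen_fapp ?leq_addr//; exact: flat_comp.
  move=> pd qd; rewrite pE flat_fapp// => /fapp_inj<- //; last exact: flat_comp.
  by rewrite flat_fapp.
apply: fpfx_eq; first by apply/flat_pfx; rewrite q0'; exact: fpfx_refl.
by apply: fpfx_len; apply/flat_pfx; rewrite q0'; exact: fpfx_refl.
Qed.

(** Once [g] is written over two flattened paths, only the common tail [u] has to be converted to a
    path of [F]. *)
Lemma flat_arrow_exists g : A (prng (ga_r g)) -> A (prng (ga_s g)) ->
  exists h, flat_arrow g h.
Proof.
move=> Ar As; have [p [q [pq gpq]]] := arrow_factor Ar As.
have /cylinderP[u [pu qu Xu [rg kg sg]]] := gpq.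
have Au : A (prng u) by rewrite -pu fsrc_flat; exact: svalP.
have [t ut] := flat_rel_exists Au.
have Xt : boundary t.
  exact: (flat_rel_boundary noheads singA acyclicT T1 T3 T4 Xu Au ut).
have pt : fsrc p = prng t by apply: sval_inj; rewrite -fsrc_flat pu (flat_rel_prng ut).
have qt : fsrc q = prng t by rewrite -pq.
have [h [hpq rh kh sh]] := arrow_exists pt qt Xt.
exists h; split; last by exists p, q.
- by rewrite rg rh; exact: flat_rel_papp.
- by rewrite sg sh; exact: flat_rel_papp.
Qed.

Lemma flat_arrow_surj h : exists g,
  [/\ A (prng (ga_r g)), A (prng (ga_s g)) & flat_arrow g h].
Proof.
have [p [q hpq]] := cylinder_exists h.
have /cylinderP[t [pt qt Xt [rh kh sh]]] := hpq.
have [u [Xu Au ut]] := flat_rel_surj singA Xt.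
have pu : fsrc (flat p) = prng u by rewrite fsrc_flat pt (flat_rel_prng ut).
have qu : fsrc (flat q) = prng u by rewrite fsrc_flat qt (flat_rel_prng ut).
have [g [gpq rg kg sg]] := arrow_exists pu qu Xu.
exists g; split.
- by rewrite rg prng_papp//; exact: (svalP (frng p)).
- by rewrite sg prng_papp//; exact: (svalP (frng q)).
- split; last by exists p, q.
    by rewrite rg rh; exact: flat_rel_papp.
  by rewrite sg sh; exact: flat_rel_papp.
Qed.

Lemma flat_arrow_inj g g' h : A (prng (ga_r g)) -> A (prng (ga_s g)) ->
  flat_arrow g h -> flat_arrow g' h -> g = g'.
Proof.
move=> Ar As gh gh'; have [rr ss [p [q [hpq gpq]]]] := gh.
have [rr' ss' _] := gh'.
have := (flat_arrow_cylinder gh' (cylinder_src hpq)).1 hpq => gpq'.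
apply: garrow_eq.
- exact: (flat_rel_inj singA T1 T4 (boundary_r g) (boundary_r g') Ar rr rr').
- by rewrite (cylinder_deg gpq) (cylinder_deg gpq').
- exact: (flat_rel_inj singA T1 T4 (boundary_s g) (boundary_s g') As ss ss').
Qed.

(** By the correspondence of cylinders, [g] determines the cylinders that contain [h]. *)
Lemma flat_arrow_fun g h h' : flat_arrow g h -> flat_arrow g h' -> h = h'.
Proof.
move=> gh gh'; apply: garrow_ext => p q.
have [pq|pq] := pselect (fsrc p = fsrc q); last by split=> /cylinder_src.
by rewrite (flat_arrow_cylinder gh pq) (flat_arrow_cylinder gh' pq).
Qed.

Lemma flat_arrow_rng g h : flat_arrow g h -> flat_arrow (ga_rng g) (ga_rng h).
Proof.
move=> [rr ss [p [q [hpq gpq]]]]; split=> //; exists p, p.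
by split; apply/cylinder_rng; [exact: cylinder_pfxr hpq|exact: cylinder_pfxr gpq].
Qed.

Lemma flat_arrow_inv g h : flat_arrow g h -> flat_arrow (ga_inv g) (ga_inv h).
Proof.
by move=> [rr ss [p [q [hpq gpq]]]]; split=> //; exists q, p; rewrite -!cylinder_inv.
Qed.

Lemma flat_arrow_src g h : flat_arrow g h -> flat_arrow (ga_src g) (ga_src h).
Proof. by move=> /flat_arrow_inv/flat_arrow_rng. Qed.

Lemma flat_arrow_mul g1 g2 h1 h2 : ga_s g1 = ga_r g2 -> ga_s h1 = ga_r h2 ->
  flat_arrow g1 h1 -> flat_arrow g2 h2 -> flat_arrow (ga_mul g1 g2) (ga_mul h1 h2).
Proof.
move=> gg hh gh1 gh2.
have [r1 s1 _] := gh1; have [r2 s2 _] := gh2.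
have [gr gs _] := ga_mulE gg; have [hr hs _] := ga_mulE hh.
split; rewrite ?gr ?gs ?hr ?hs//.
have [p [q [r [pq qr]]]] := composable_cylinders hh.
exists p, r; split; first exact: cylinder_mul hh pq qr.
apply: (cylinder_mul gg).
  exact/(flat_arrow_cylinder gh1 (cylinder_src pq)).
exact/(flat_arrow_cylinder gh2 (cylinder_src qr)).
Qed.

(** * Isomorphism and equivalence for the pointed groupoid *)

Lemma pointed_closed_set (S : set (vert E)) : closed (@pointed_set E S).
Proof.
have cr : closed [set g : graph_groupoid E | S (prng (ga_r g))].
  by rewrite -openC; exact: (@open_prng E (~` S)).
rewrite (_ : @pointed_set E S = [set g | S (prng (ga_r g))] `&`
    (@ga_inv E) @^-1` [set g | S (prng (ga_r g))]); last first.
  by apply/seteqP; split=> g /pointed_setE.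
apply: closedI => //; apply: (closed_comp _ cr) => g _.
exact: ga_inv_continuous.
Qed.

Lemma pointed_isomorphic : isomorphic (pointed_groupoid A) (graph_groupoid F).
Proof.
have Ar (g : pointed_groupoid A) : A (prng (ga_r (\val g))).
  by have /pointed_setE[] := set_valP g.
have As (g : pointed_groupoid A) : A (prng (ga_s (\val g))).
  by have /pointed_setE[] := set_valP g.
have [f fP] := choice (fun g : pointed_groupoid A => flat_arrow_exists (Ar g) (As g)).
have finj : injective f.
  move=> g g' e; apply: val_inj; apply: (flat_arrow_inj (Ar g) (As g) (fP g)).
  by rewrite e.
have fsurj h : exists w, f w = h.
  have [g [gr gs gh]] := flat_arrow_surj h.
  pose w : pointed_groupoid A :=
    exist _ g (mem_set ((pointed_setE _ _).2 (conj gr gs))).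
  by exists w; exact: (flat_arrow_fun (fP w) gh).
have [k fk] := choice fsurj.
have kf : cancel f k by move=> w; apply: finj; rewrite fk.
have cf : continuous f.
  move=> g; have FF : Filter (f g' @[g' --> g]).
    by apply: fmap_filter; exact: nbhs_filter.
  apply/garrow_cvgP => p q.
  have [pq|npq] := pselect (fsrc p = fsrc q); last first.
    split=> [/cylinder_src//|_]; apply: (@filterS _ (nbhs g) _ setT) => //.
      by move=> ? _ /cylinder_src.
    exact: filterT.
  split=> H.
    have gpq := (flat_arrow_cylinder (fP g) pq).1 H.
    have : nbhs g [set w | cylinder (flat p) (flat q) (\val w)].
      exact: (set_val_continuous (near_cylinder gpq)).
    by apply: filterS => w wpq; exact/(flat_arrow_cylinder (fP w) pq).
  have ngpq : ~ cylinder (flat p) (flat q) (\val g).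
    by move=> /(flat_arrow_cylinder (fP g) pq).
  have : nbhs g [set w | ~ cylinder (flat p) (flat q) (\val w)].
    exact: (set_val_continuous (near_cylinderC ngpq)).
  by apply: filterS => w nw /(flat_arrow_cylinder (fP w) pq).
exists f; split; last first.
  split.
  - by exists k.
  - move=> g; apply/esym/(flat_arrow_fun (fP _)); exact: flat_arrow_rng.
  - move=> g; apply/esym/(flat_arrow_fun (fP _)); exact: flat_arrow_src.
  - move=> g g' /(congr1 \val)/= gg.
    have ff : ga_s (f g) = ga_r (f g').
      apply: ga_compos; apply: (flat_arrow_fun (flat_arrow_src (fP g))).
      by rewrite [ga_src _]gg; exact: (flat_arrow_rng (fP g')).
    apply: (flat_arrow_fun (fP _)); rewrite val_sub_mul//.
    by apply: flat_arrow_mul => //; exact: ga_compos.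
apply: (@locally_compact_homeomorphism _ _ f k) => //.
  exact: garrow_hausdorff.
(* The trace of [Z(flat p, flat q)] is compact because the pointed groupoid is closed in [G_E], and
   its image is exactly [Z(p, q)]. *)
move=> g; have [p [q [pq gpq]]] := arrow_factor (Ar g) (As g).
exists [set g' : pointed_groupoid A | cylinder (flat p) (flat q) (\val g')]; split.
- exact: (set_val_continuous (near_cylinder gpq)).
- by apply: set_type_compact; [exact: pointed_closed_set|exact: compact_cylinder].
- rewrite (_ : _ @` _ = cylinder p q); first exact: open_cylinder.
  apply/seteqP; split=> [_ [g' gc <-]|h hpq].
    exact/(flat_arrow_cylinder (fP g') pq).
  exists (k h) => //=; apply/(flat_arrow_cylinder (fP (k h)) pq).
  by rewrite fk.
Qed.

Lemma pointed_equivalent : equivalent (pointed_groupoid A) (graph_groupoid E).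
Proof.
have cW : closed [set g : graph_groupoid E | A (prng (ga_r g))].
  by rewrite -openC; exact: (@open_prng E (~` A)).
apply: (@full_reduction_equivalent (graph_groupoid E)
  [set g : garrow E | A (prng (ga_r g))] (@pointed_set E A)) => //.
- exact: graph_lch_groupoid.
- exact: ga_rng_continuous.
- exact: ga_rng_open.
- exact: open_prng.
- exact: pointed_setE.
(* Fullness: a path [c u] with the source of [c] in [A] is joined to its remainder [u], whose range
   lies in [A]. *)
- move=> g gg; have [[c [cg sc]]|nc] := pselect (exists c, pfx c (ga_r g) /\ A (fsrc c)).
    have [u [cu rE]] := cg.
    have vu : fsrc (vpath (fsrc c)) = prng u by [].
    have Xu : boundary u by have := boundary_r g; rewrite rE boundary_papp.
    have [h [_ hr hk hs]] := arrow_exists vu cu Xu.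
    exists h; first by rewrite /= hr prng_papp.
    have hsr : ga_s h = ga_r g by rewrite hs rE.
    by rewrite -gg; apply: garrow_eq.
  have [c cg|x [y rE xy]] := avoids_complement (boundary_r g).
    by move=> sc; apply: nc; exists c.
  (* A path that avoids [A] lies in [T]; prepending the path [m] given by (T2) moves its range into
     [A]. *)
  have [m [Am sm]] := T2 x.
  have mr : fsrc m = prng (ga_r g) by rewrite sm rE /= /irng /= xy.
  have vr : fsrc (vpath (prng (ga_r g))) = prng (ga_r g) by [].
  have [h [_ hr hk hs]] := arrow_exists mr vr (boundary_r g).
  exists h; first by rewrite /= hr prng_papp.
  have hsr : ga_s h = ga_r g by rewrite hs vpath_papp.
  by rewrite -gg; apply: garrow_eq.
Qed.

End Arrows.

Theorem proposition6p2 (E : digraph) (F0 : set (vert E))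
    (noheads : forall x : infpath E, ~ is_head x)
    (singF0 : @singular E `<=` F0)
    (acyclicT : acyclic (complement_graph F0))
    (T1 : forall v, F0 v ->
      is_subset1 [set y : infpath E | irng y = v /\ forall i, ~ F0 (src (y i))])
    (T2 : forall x : infpath (complement_graph F0), reaches (sval (irng x)) F0)
    (T3 : forall x : infpath (complement_graph F0),
      forall i, emits (rng (sval (x i))) #= `I_1)
    (T4 : forall x : infpath (complement_graph F0),
      forall e : edge E, src e = sval (irng x) -> finite_set (receives (rng e))) :
  equivalent (pointed_groupoid F0) (graph_groupoid E) /\
  isomorphic (pointed_groupoid F0) (graph_groupoid (contracted_graph F0)).
Proof.
split; first exact: pointed_equivalent.
exact: pointed_isomorphic.
Qed.
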